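(* For any integer $n \geq 1$, there are infinitely many (pairwise non-isomorphic) finite simple $n$-connected graphs $G$ which have non-free linear embeddings; that is, for each such $G$ there exists a linear embedding $f: G \to \mathbb{R}^3$ such that $\pi_1(\mathbb{R}^3 - f(G))$ is not a free group.
   Context: A graph is simple if it has no loop edges and no multiple edges between any two vertices. A graph is $n$-connected (in the standard sense of vertex connectivity) if it has more than $n$ vertices and remains connected after deletion of any set of fewer than $n$ vertices. A graph is regarded as a topological space (a 1-dimensional complex) when speaking of embeddings. An embedding $f: G \to \mathbb{R}^3$ is called linear if each edge of $G$ is sent to a line segment in $\mathbb{R}^3$. An embedding $f: G \to \mathbb{R}^3$ of a finite connected graph is called free if $\pi_1(\mathbb{R}^3 - f(G))$ is a free group, and non-free otherwise. *)

(* Defs.v *)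
From HB Require Import structures.
From mathcomp Require Import all_boot all_order all_algebra.
From mathcomp Require Import all_classical reals topology normedtype.
From mathcomp Require Import homotopy.
From mathcomp Require Import ring lra.
Import Order.TTheory GRing.Theory Num.Theory.
Import numFieldNormedType.Exports.

Set Implicit Arguments.
Unset Strict Implicit.
Unset Printing Implicit Defensive.

Local Open Scope classical_set_scope.
Local Open Scope ring_scope.

Section unit_interval.
Variable R : realType.

Definition unitI : Type := set_type (`[0%R, 1%R]%classic : set R).
HB.instance Definition _ := Topological.on unitI.

Definition unitI_val (t : unitI) : R := \val t.

Definition clamp_val (r : R) : R := Num.max 0 (Num.min 1 r).

Lemma clamp_val_in (r : R) : clamp_val r \in (`[0%R, 1%R]%classic : set R).
Proof.
rewrite inE /= in_itv /= /clamp_val le_max lexx /= ge_max ler01 /=.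
by rewrite ge_min lexx.
Qed.

Definition clamp (r : R) : unitI := exist _ (clamp_val r) (clamp_val_in r).

Lemma unitI_bounds (t : unitI) : 0 <= unitI_val t <= 1.
Proof. by have := set_valP t; rewrite /= in_itv /= => -[]. Qed.

Lemma unitI_inj : injective unitI_val.
Proof. exact: val_inj. Qed.

Lemma clampK (r : R) : 0 <= r <= 1 -> unitI_val (clamp r) = r.
Proof.
by move=> /andP[r0 r1]; rewrite /unitI_val /= /clamp_val min_r // max_r.
Qed.

Lemma unitIK (t : unitI) : clamp (unitI_val t) = t.
Proof. by apply: unitI_inj; rewrite clampK // unitI_bounds. Qed.

Lemma unitI_val_continuous : continuous unitI_val.
Proof. exact: (@initial_continuous (set_type _) R). Qed.

Lemma clamp_continuous : continuous clamp.
Proof.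
have cv : continuous clamp_val.
  move=> r; apply: (@continuous_max R R); first exact: cvg_cst.
  by apply: (@continuous_min R R); [exact: cvg_cst|exact: cvg_id].
apply/continuousP => U [V oV <-].
by have /continuousP/(_ _ oV) := cv.
Qed.

Local Lemma unitI01 : clamp 0 != clamp 1.
Proof.
apply/eqP => /(congr1 unitI_val); rewrite !clampK ?lexx ?ler01 //.
by move/eqP; rewrite eq_sym oner_eq0.
Qed.

HB.instance Definition _ := @isBiPointed.Build unitI (clamp 0) (clamp 1) unitI01.

End unit_interval.

Section glue.
Variables (R : realType) (T U : topologicalType).

Lemma continuous_glue (h : T -> R) (c : R) (f g : T -> U) :
  continuous h -> continuous f -> continuous g ->
  (forall t, h t = c -> f t = g t) ->
  continuous (fun t => if h t <= c then f t else g t).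
Proof.
move=> ch cf cg fg; apply/continuous_subspace_setT.
have -> : [set: T] = [set t | h t <= c] `|` [set t | c <= h t].
  by apply/seteqP; split => // t _ /=; apply/orP; exact: le_total.
apply: withinU_continuous.
- rewrite (_ : [set t | _] = h @^-1` [set r | r <= c]) //.
  by move/continuous_closedP : ch; apply; exact: closed_le.
- rewrite (_ : [set t | _] = h @^-1` [set r | c <= r]) //.
  by move/continuous_closedP : ch; apply; exact: closed_ge.
- apply: (@subspace_eq_continuous _ _ _ f).
    by move=> t; rewrite inE /= /from_subspace => ->.
  exact: continuous_subspaceT.
- apply: (@subspace_eq_continuous _ _ _ g).
    move=> t; rewrite inE /= /from_subspace => cht.
    by case: ifPn => // htc; rewrite fg //; apply/eqP; rewrite eq_le htc.
  exact: continuous_subspaceT.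
Qed.

End glue.

Section path_homotopy.
Variables (R : realType) (X : topologicalType).
Implicit Types x y z : X.

Local Notation I := (unitI R).
Local Notation path x y := {path I from x to y in X}.

(* Homotopy relative to the endpoints; the second coordinate of H is time. *)
Definition path_homotopic x y (p q : path x y) : Prop :=
  exists H : I * I -> X, [/\ continuous H,
    forall t, H (t, zero) = p t, forall t, H (t, one) = q t,
    forall s, H (zero, s) = x & forall s, H (one, s) = y].

Local Lemma zeroE : unitI_val (zero : I) = 0.
Proof. by rewrite clampK // lexx ler01. Qed.

Local Lemma oneE : unitI_val (one : I) = 1.
Proof. by rewrite clampK // lexx ler01. Qed.

Local Lemma clamp_le0 (r : R) : r <= 0 -> clamp r = zero.
Proof.
move=> r0; apply: unitI_inj; rewrite zeroE /unitI_val /= /clamp_val.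
by rewrite max_l // ge_min r0 orbT.
Qed.

Local Lemma clamp_ge1 (r : R) : 1 <= r -> clamp r = one.
Proof.
by move=> r1; apply: unitI_inj; rewrite oneE /unitI_val /= /clamp_val min_l // max_r.
Qed.

Local Lemma cclamp (T : topologicalType) (f : T -> R) :
  continuous f -> continuous (fun t => clamp (f t)).
Proof.
by move=> cf t; apply: continuous_comp; [exact: cf|exact: clamp_continuous].
Qed.

Local Lemma cval (T : topologicalType) (f : T -> I) :
  continuous f -> continuous (fun t => unitI_val (f t)).
Proof.
by move=> cf t; apply: continuous_comp; [exact: cf|exact: unitI_val_continuous].
Qed.

Local Lemma ccomp (S T U : topologicalType) (f : S -> T) (g : T -> U) :
  continuous g -> continuous f -> continuous (fun t => g (f t)).
Proof.
by move=> cg cf t; apply: continuous_comp; [exact: cf|exact: cg].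
Qed.

Local Lemma cpair (S T U : topologicalType) (f : S -> T) (g : S -> U) :
  continuous f -> continuous g -> continuous (fun t => (f t, g t)).
Proof. by move=> cf cg t; apply: cvg_pair; [exact: cf|exact: cg]. Qed.

Local Lemma cfst (S T : topologicalType) : continuous (@fst S T).
Proof. by move=> t; exact: cvg_fst. Qed.

Local Lemma csnd (S T : topologicalType) : continuous (@snd S T).
Proof. by move=> t; exact: cvg_snd. Qed.

Local Lemma ccst (T : topologicalType) (c : R) : continuous (fun _ : T => c).
Proof. by move=> t; exact: cvg_cst. Qed.

Local Lemma cadd (T : topologicalType) (f g : T -> R) :
  continuous f -> continuous g -> continuous (fun t => f t + g t).
Proof. by move=> cf cg t; apply: (@cvgD R R); [exact: cf|exact: cg]. Qed.

Local Lemma copp (T : topologicalType) (f : T -> R) :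
  continuous f -> continuous (fun t => - f t).
Proof. by move=> cf t; apply: (@cvgN R R); exact: cf. Qed.

Local Lemma cmul (T : topologicalType) (f g : T -> R) :
  continuous f -> continuous g -> continuous (fun t => f t * g t).
Proof. by move=> cf cg t; apply: (@cvgM R); [exact: cf|exact: cg]. Qed.

Local Lemma cmax (T : topologicalType) (f g : T -> R) :
  continuous f -> continuous g -> continuous (fun t => Num.max (f t) (g t)).
Proof. by move=> cf cg t; apply: (@continuous_max R T); [exact: cf|exact: cg]. Qed.

Local Lemma cunit : continuous (@unitI_val R).
Proof. exact: unitI_val_continuous. Qed.

Local Lemma cpath x y (p : path x y) : continuous p.
Proof. exact: cts_fun. Qed.

Ltac ctac := repeat first
  [ exact: ccst | exact: cunit | exact: cfst | exact: csnd | exact: cpath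
  | apply: cadd | apply: copp | apply: cmul | apply: cmax
  | apply: cclamp | apply: cval | apply: cpair ].

Section concatenation.
Variables (x y z : X) (p : path x y) (q : path y z).

Definition path_concat_fun (t : I) : X :=
  if unitI_val t <= 2^-1 then p (clamp (2 * unitI_val t))
  else q (clamp (2 * unitI_val t - 1)).

Local Lemma concat_continuous : continuous path_concat_fun.
Proof.
apply: continuous_glue; first by ctac.
- by apply: ccomp; ctac.
- by apply: ccomp; ctac.
- move=> t ->; rewrite clamp_ge1 ?clamp_le0 ?path_one ?path_zero //; lra.
Qed.

Local Lemma concat_zero : path_concat_fun zero = x.
Proof. by rewrite /path_concat_fun zeroE ifT ?clamp_le0 ?path_zero //; lra. Qed.

Local Lemma concat_one : path_concat_fun one = z.
Proof.
by rewrite /path_concat_fun oneE ifF ?clamp_ge1 ?path_one //; lra.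
Qed.

Definition path_concat : path x z :=
  mk_path concat_continuous concat_zero concat_one.

End concatenation.

Section reversal.
Variables (x y : X) (p : path x y).

Definition path_rev_fun (t : I) : X := p (clamp (1 - unitI_val t)).

Local Lemma rev_continuous : continuous path_rev_fun.
Proof. by apply: ccomp; ctac. Qed.

Local Lemma rev_zero : path_rev_fun zero = y.
Proof. by rewrite /path_rev_fun zeroE clamp_ge1 ?path_one //; lra. Qed.

Local Lemma rev_one : path_rev_fun one = x.
Proof. by rewrite /path_rev_fun oneE clamp_le0 ?path_zero //; lra. Qed.

Definition path_rev : path y x := mk_path rev_continuous rev_zero rev_one.

End reversal.

Definition path_const x : path x x := cst x.

Lemma path_homotopic_refl x y (p : path x y) : path_homotopic p p.
Proof.
exists (fun ts => p ts.1); split => //= [|s|s]; rewrite ?path_zero ?path_one //.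
by apply: ccomp; ctac.
Qed.

Lemma path_homotopic_sym x y (p q : path x y) :
  path_homotopic p q -> path_homotopic q p.
Proof.
move=> [H [cH H0 H1 Hx Hy]].
exists (fun ts => H (ts.1, clamp (1 - unitI_val ts.2))); split => //=.
- by apply: ccomp cH _; ctac.
- by move=> t; rewrite zeroE clamp_ge1 ?H1 //; lra.
- by move=> t; rewrite oneE clamp_le0 ?H0 //; lra.
Qed.

Lemma path_homotopic_trans x y (p q r : path x y) :
  path_homotopic p q -> path_homotopic q r -> path_homotopic p r.
Proof.
move=> [H [cH H0 H1 Hx Hy]] [K [cK K0 K1 Kx Ky]].
exists (fun ts => if unitI_val ts.2 <= 2^-1
  then H (ts.1, clamp (2 * unitI_val ts.2))
  else K (ts.1, clamp (2 * unitI_val ts.2 - 1))); split => /=.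
- apply: continuous_glue; first by ctac.
  + by apply: ccomp cH _; ctac.
  + by apply: ccomp cK _; ctac.
  + by move=> -[t s] /= ->; rewrite clamp_ge1 ?clamp_le0 ?H1 ?K0 //; lra.
- by move=> t; rewrite zeroE ifT ?clamp_le0 ?H0 //; lra.
- by move=> t; rewrite oneE ifF ?clamp_ge1 ?K1 //; lra.
- by move=> s; case: ifP; rewrite ?Hx ?Kx.
- by move=> s; case: ifP; rewrite ?Hy ?Ky.
Qed.

Lemma path_homotopic_concat x y z (p p' : path x y) (q q' : path y z) :
  path_homotopic p p' -> path_homotopic q q' ->
  path_homotopic (path_concat p q) (path_concat p' q').
Proof.
move=> [H [cH H0 H1 Hx Hy]] [K [cK K0 K1 Kx Ky]].
exists (fun ts => if unitI_val ts.1 <= 2^-1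
  then H (clamp (2 * unitI_val ts.1), ts.2)
  else K (clamp (2 * unitI_val ts.1 - 1), ts.2)); split => /=.
- apply: continuous_glue; first by ctac.
  + by apply: ccomp cH _; ctac.
  + by apply: ccomp cK _; ctac.
  + by move=> -[t s] /= ->; rewrite clamp_ge1 ?clamp_le0 ?Hy ?Kx //; lra.
- by move=> t; rewrite H0 K0.
- by move=> t; rewrite H1 K1.
- by move=> s; rewrite zeroE ifT ?clamp_le0 ?Hx //; lra.
- by move=> s; rewrite oneE ifF ?clamp_ge1 ?Ky //; lra.
Qed.

Lemma path_homotopic_rev x y (p q : path x y) :
  path_homotopic p q -> path_homotopic (path_rev p) (path_rev q).
Proof.
move=> [H [cH H0 H1 Hx Hy]].
exists (fun ts => H (clamp (1 - unitI_val ts.1), ts.2)); split => /=.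
- by apply: ccomp cH _; ctac.
- by move=> t; rewrite H0.
- by move=> t; rewrite H1.
- by move=> s; rewrite zeroE clamp_ge1 ?Hy //; lra.
- by move=> s; rewrite oneE clamp_le0 ?Hx //; lra.
Qed.

(* Two reparametrisations of a path with the same endpoints are homotopic,
   by straight-line homotopy of the parameter. *)
Lemma path_homotopic_reparam x y x' y' (u : path x' y') (f g : I -> R)
    (p q : path x y) :
  continuous f -> continuous g ->
  (forall t, p t = u (clamp (f t))) -> (forall t, q t = u (clamp (g t))) ->
  f zero = g zero -> f one = g one -> path_homotopic p q.
Proof.
move=> cf cg pE qE fg0 fg1.
exists (fun ts => u (clamp ((1 - unitI_val ts.2) * f ts.1 +
                            unitI_val ts.2 * g ts.1))); split => /=.
- apply: (ccomp (@cpath _ _ u)); ctac.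
    exact: (ccomp cf (@cfst _ _)).
  exact: (ccomp cg (@cfst _ _)).
- by move=> t; rewrite zeroE subr0 mul1r mul0r addr0.
- by move=> t; rewrite oneE subrr mul1r mul0r add0r.
- move=> s; rewrite -fg0 -mulrDl subrK mul1r -pE; exact: path_zero.
- move=> s; rewrite -fg1 -mulrDl subrK mul1r -pE; exact: path_one.
Qed.

Local Lemma concat_l x y z (p : path x y) (q : path y z) (r : R) :
  0 <= r <= 2^-1 -> path_concat p q (clamp r) = p (clamp (2 * r)).
Proof.
move=> r01; rewrite -[LHS]/(path_concat_fun p q _) /path_concat_fun.
by rewrite clampK ?ifT //; lra.
Qed.

Local Lemma concat_r x y z (p : path x y) (q : path y z) (r : R) :
  2^-1 <= r <= 1 -> path_concat p q (clamp r) = q (clamp (2 * r - 1)).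
Proof.
move=> r01; rewrite -[LHS]/(path_concat_fun p q _) /path_concat_fun.
rewrite clampK; last by lra.
case: ifPn => // r2; have -> : r = 2^-1 by lra.
by rewrite clamp_ge1 ?clamp_le0 ?path_one ?path_zero //; lra.
Qed.

Local Lemma revE x y (p : path x y) (r : R) :
  0 <= r <= 1 -> path_rev p (clamp r) = p (clamp (1 - r)).
Proof. by move=> r01; rewrite -[LHS]/(path_rev_fun p _) /path_rev_fun clampK. Qed.

Local Lemma unitIP (P : I -> Prop) :
  (forall r, 0 <= r <= 1 -> P (clamp r)) -> forall t, P t.
Proof. by move=> Pc t; rewrite -(unitIK t); apply: Pc; exact: unitI_bounds. Qed.

Lemma path_concatA x y z w (p : path x y) (q : path y z) (r : path z w) :
  path_homotopic (path_concat p (path_concat q r))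
                 (path_concat (path_concat p q) r).
Proof.
apply: (@path_homotopic_reparam _ _ _ _ (path_concat (path_concat p q) r)
  (fun t => Num.max (unitI_val t * 2^-1)
     (Num.max (unitI_val t - 4^-1) (2 * unitI_val t - 1)))
  (@unitI_val R)); try by ctac.
- apply: unitIP => s s01; rewrite clampK //.
  have [s1|s1] := leP s (2^-1).
    rewrite max_l ?ge_max; last by lra.
    rewrite concat_l; last by lra.
    rewrite concat_l; last by lra.
    rewrite concat_l; last by lra.
    by congr (p (clamp _)); lra.
  have [s2|s2] := leP s (3 / 4).
    rewrite max_r ?le_max; last by lra.
    rewrite max_l; last by lra.
    rewrite concat_r; last by lra.
    rewrite concat_l; last by lra.
    rewrite concat_l; last by lra.
    rewrite concat_r; last by lra.
    by congr (q (clamp _)); lra.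
  rewrite max_r ?le_max; last by lra.
  rewrite max_r; last by lra.
  rewrite concat_r; last by lra.
  rewrite concat_r; last by lra.
  rewrite concat_r; last by lra.
  by congr (r (clamp _)); lra.
- by move=> t; rewrite unitIK.
- by rewrite zeroE max_l ?ge_max; lra.
- by rewrite oneE max_r ?le_max; [rewrite max_r; lra|lra].
Qed.

Lemma path_concat_const_l x y (p : path x y) :
  path_homotopic (path_concat (path_const x) p) p.
Proof.
apply: (@path_homotopic_reparam _ _ _ _ p
  (fun t => Num.max 0 (2 * unitI_val t - 1)) (@unitI_val R)); try by ctac.
- apply: unitIP => s s01; rewrite clampK //.
  have [s1|s1] := leP s (2^-1).
    rewrite max_l ?concat_l; [|by lra..].
    by rewrite (@clamp_le0 0) ?path_zero.
  by rewrite max_r ?concat_r //; lra.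
- by move=> t; rewrite unitIK.
- by rewrite zeroE max_l; lra.
- by rewrite oneE max_r; lra.
Qed.

Lemma path_concat_const_r x y (p : path x y) :
  path_homotopic (path_concat p (path_const y)) p.
Proof.
apply: (@path_homotopic_reparam _ _ _ _ p
  (fun t => - Num.max (-1) (- 2 * unitI_val t)) (@unitI_val R)); try by ctac.
- apply: unitIP => s s01; rewrite clampK //.
  have [s1|s1] := leP s (2^-1).
    rewrite max_r ?concat_l; [|by lra..].
    by congr (p (clamp _)); lra.
  rewrite max_l ?concat_r; [|by lra..].
  by rewrite opprK (@clamp_ge1 1) ?path_one.
- by move=> t; rewrite unitIK.
- by rewrite zeroE max_r; lra.
- by rewrite oneE max_l; lra.
Qed.

Lemma path_concat_rev_l x y (p : path x y) :
  path_homotopic (path_concat (path_rev p) p) (path_const y).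
Proof.
apply: (@path_homotopic_reparam _ _ _ _ p
  (fun t => Num.max (1 - 2 * unitI_val t) (2 * unitI_val t - 1))
  (fun=> 1)); try by ctac.
- apply: unitIP => s s01; rewrite clampK //.
  have [s1|s1] := leP s (2^-1).
    by rewrite max_l ?concat_l ?revE //; lra.
  by rewrite max_r ?concat_r //; lra.
- by move=> t; rewrite clamp_ge1 ?path_one.
- by rewrite zeroE max_l; lra.
- by rewrite oneE max_r; lra.
Qed.

Lemma path_concat_rev_r x y (p : path x y) :
  path_homotopic (path_concat p (path_rev p)) (path_const x).
Proof.
apply: (@path_homotopic_reparam _ _ _ _ p
  (fun t => - Num.max (- (2 * unitI_val t)) (2 * unitI_val t - 2))
  (fun=> 0)); try by ctac.
- apply: unitIP => s s01; rewrite clampK //.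
  have [s1|s1] := leP s (2^-1).
    rewrite max_l ?concat_l; [|by lra..].
    by congr (p (clamp _)); lra.
  rewrite max_r ?concat_r ?revE; [|by lra..].
  by congr (p (clamp _)); lra.
- by move=> t; rewrite clamp_le0 ?path_zero.
- by rewrite zeroE max_l; lra.
- by rewrite oneE max_r; lra.
Qed.

End path_homotopy.

Section fundamental_group.
Local Open Scope quotient_scope.
Variables (R : realType) (X : topologicalType) (x : X).

Local Notation loop := {path (unitI R) from x to x in X}.

Definition loop_homotopic (p q : loop) : bool := `[< path_homotopic p q >].

Local Lemma loop_homotopic_refl : reflexive loop_homotopic.
Proof. by move=> p; apply/asboolP; exact: path_homotopic_refl. Qed.

Local Lemma loop_homotopic_sym : symmetric loop_homotopic.
Proof.
by move=> p q; apply/asboolP/asboolP => /path_homotopic_sym.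
Qed.

Local Lemma loop_homotopic_trans : transitive loop_homotopic.
Proof.
move=> q p r /asboolP pq /asboolP qr; apply/asboolP.
exact: path_homotopic_trans pq qr.
Qed.

Definition loop_equiv := EquivRel loop_homotopic
  loop_homotopic_refl loop_homotopic_sym loop_homotopic_trans.

Definition fundamental_group : Type := {eq_quot loop_equiv}.
HB.instance Definition _ := Choice.on fundamental_group.
HB.instance Definition _ := Quotient.on fundamental_group.

Local Notation pi1 := fundamental_group.
Local Notation class p := (\pi_pi1 p).

Lemma loop_classP (p q : loop) : class p = class q <-> path_homotopic p q.
Proof.
split => [/eqmodP/asboolP //|pq]; apply/eqmodP; exact/asboolP.
Qed.

Definition pi1_one : pi1 := class (path_const R x).
Definition pi1_mul (a b : pi1) : pi1 := class (path_concat (repr a) (repr b)).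
Definition pi1_inv (a : pi1) : pi1 := class (path_rev (repr a)).

Local Lemma repr_class (p : loop) : path_homotopic (repr (class p)) p.
Proof. by apply/loop_classP; rewrite reprK. Qed.

Lemma pi1_mulE (p q : loop) :
  pi1_mul (class p) (class q) = class (path_concat p q).
Proof. by apply/loop_classP; apply: path_homotopic_concat; exact: repr_class. Qed.

Lemma pi1_invE (p : loop) : pi1_inv (class p) = class (path_rev p).
Proof. by apply/loop_classP; apply: path_homotopic_rev; exact: repr_class. Qed.

Local Lemma pi1_mulA : associative pi1_mul.
Proof.
elim/quotW=> p; elim/quotW=> q; elim/quotW=> r.
rewrite (pi1_mulE q r) (pi1_mulE p q) !pi1_mulE.
by apply/loop_classP; exact: path_concatA.
Qed.

Local Lemma pi1_mul1 : left_id pi1_one pi1_mul.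
Proof.
elim/quotW=> p; rewrite pi1_mulE.
by apply/loop_classP; exact: path_concat_const_l.
Qed.

Local Lemma pi1_mul1r : right_id pi1_one pi1_mul.
Proof.
elim/quotW=> p; rewrite pi1_mulE.
by apply/loop_classP; exact: path_concat_const_r.
Qed.

Local Lemma pi1_mulV : left_inverse pi1_one pi1_inv pi1_mul.
Proof.
elim/quotW=> p; rewrite pi1_invE pi1_mulE.
by apply/loop_classP; exact: path_concat_rev_l.
Qed.

Local Lemma pi1_mulVr : right_inverse pi1_one pi1_inv pi1_mul.
Proof.
elim/quotW=> p; rewrite pi1_invE pi1_mulE.
by apply/loop_classP; exact: path_concat_rev_r.
Qed.

HB.instance Definition _ := isGroup.Build pi1
  pi1_mulA pi1_mul1 pi1_mul1r pi1_mulV pi1_mulVr.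

End fundamental_group.

(* Every map S -> H extends uniquely to a morphism G -> H; only the values of f
   on S matter. *)
Definition free_basis (G : groupType) (S : set G) : Prop :=
  forall (H : groupType) (f : G -> H),
    exists2 phi : {multiplicative G -> H},
      forall s, S s -> phi s = f s &
      forall psi : {multiplicative G -> H},
        (forall s, S s -> psi s = f s) -> psi =1 phi.

Definition free_group (G : groupType) : Prop :=
  exists S : set G, free_basis S.

Record sgraph : Type := SGraph {
  vertex :> finType;
  adj : rel vertex;
  adj_sym : symmetric adj;
  adj_irr : irreflexive adj }.

Definition sgraph_iso (G H : sgraph) : Prop :=
  exists2 f : G -> H, bijective f & forall u v, adj (f u) (f v) = adj u v.

Section vertex_connectivity.
Variables (G : sgraph).

Definition adj_off (S : {set G}) : rel G :=
  [rel u v | [&& adj u v, u \notin S & v \notin S]].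

Definition connected_off (S : {set G}) : Prop :=
  forall u v, u \notin S -> v \notin S -> connect (adj_off S) u v.

Definition n_connected (n : nat) : Prop :=
  (n < #|G|)%N /\ forall S : {set G}, (#|S| < n)%N -> connected_off S.

End vertex_connectivity.

Definition segment (R : realType) (V : lmodType R) (a b : V) : set V :=
  [set (1 - t) *: a + t *: b | t in `[0, 1]%classic].

Definition embedding (X Y : topologicalType) (f : X -> Y) : Prop :=
  [/\ continuous f, injective f &
      forall U : set X, open U -> open (f @` U : set (subspace (range f)))].

Section realization.
Variables (R : realType) (G : sgraph).

(* Vertices are placed at the standard basis vectors of R^#|G|. *)
Definition vertex_pt (v : G) : 'rV[R]_#|G| := delta_mx ord0 (enum_rank v).

Definition edge_cell (u v : G) : set 'rV[R]_#|G| :=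
  segment (vertex_pt u) (vertex_pt v).

Definition realization_set : set 'rV[R]_#|G| :=
  range vertex_pt `|` [set x | exists u v, adj u v /\ edge_cell u v x].

Definition realization : Type := set_type realization_set.
HB.instance Definition _ := Topological.on realization.

Definition linear_embedding (f : realization -> 'rV[R]_3) : Prop :=
  embedding f /\
  forall u v, adj u v ->
    exists a b, f @` [set x | edge_cell u v (\val x)] = segment a b.

Definition complement (f : realization -> 'rV[R]_3) : Type :=
  set_type (~` range f).
HB.instance Definition _ f := Topological.on (complement f).

(* The complement is nonempty and, for an embedding, path-connected, so the
   choice of base point is immaterial. *)
Definition free_embedding (f : realization -> 'rV[R]_3) : Prop :=
  forall p : complement f, free_group (fundamental_group R p).

End realization.

(* Main.v *)
(** Tie a trefoil in a polygon and replace each of its ten vertices by a cluster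
    of N vertices in general position, N >= n, joining consecutive clusters
    completely.  The resulting graph is n-connected, and it lies in a thin tube
    around the trefoil.  In the complement of the graph, a meridian m and a
    parallel l of the tube commute, because they span a torus.

    The graph still contains the trefoil, so loops in its complement act through
    the trefoil group, which maps to the wreath product of Z^2 with S_3 (3-colour
    the trefoil; the kernel of the action on one colour then has two independent
    linking numbers).  If the fundamental group were free, this map would lift to
    the wreath product of the Heisenberg group with S_3, a group surjecting onto
    the former.  But m and l fix a colour at which their Z^2-weights are linearly
    independent, so their lifts do not commute. *)

From HB Require Import structures.
Require Import Defs.
From mathcomp Require Import all_boot all_order all_algebra perm.
From mathcomp Require Import all_classical reals topology normedtype.
From mathcomp Require Import homotopy interval_inference.
From mathcomp Require Import ring lra.
Import Order.TTheory GRing.Theory Num.Theory.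
Import numFieldNormedType.Exports.
Set Implicit Arguments.
Unset Strict Implicit.
Unset Printing Implicit Defensive.
Local Open Scope classical_set_scope.
Local Open Scope ring_scope.

(** * Transport along paths of a locally defined cocycle *)

(** No presentation of a fundamental group is derived: a homomorphism out of it suffices. It
    multiplies, along a finely subdivided loop, group elements attached to pairs of nearby points,
    and is well defined as soon as these elements satisfy the cocycle identity locally. The
    open-book position is chosen so that they depend only on signs of affine forms; both the cocycle
    identity and the evaluation on explicit polygons then reduce to linear arithmetic.

    The abelianization of the trefoil group is infinite cyclic, so it cannot show that m and l are
    independent. This forces the passage to the stabiliser of a colour, of index three, which the
    wreath product records without leaving the whole group. Freeness enters only through its
    universal property, as a lifting property along a surjection; subgroups of free groups are never
    studied.

    Apart from one vertex per cluster, the graph is known only up to a small error, so the torus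
    around it is given by integer points and certified disjoint by integer normals that leave room
    for the error. *)

Section local_cocycle.
Local Open Scope group_scope.
Variables (X : topologicalType) (Q : groupType) (T : X -> X -> Q).

(* A local trivialisation of a principal Q-bundle in disguise: T x y compares the
   fibres over x and y, and is meaningful only for close enough x and y. *)
Definition cocycle_on (A : set X) : Prop :=
  forall x y z, A x -> A y -> A z -> T x y * T y z = T x z.

Lemma cocycle_onS (A B : set X) : A `<=` B -> cocycle_on B -> cocycle_on A.
Proof. by move=> AB cB x y z /AB ? /AB ? /AB ?; apply: cB. Qed.

Lemma cocycle_refl (A : set X) x : cocycle_on A -> A x -> T x x = 1.
Proof. by move=> cA Ax; apply: (mulgI (T x x)); rewrite mulg1 cA. Qed.

Fixpoint holonomy (f : nat -> X) (n : nat) : Q :=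
  if n is m.+1 then holonomy f m * T (f m) (f m.+1) else 1.

Lemma eq_holonomy f g n : (forall i, (i <= n)%N -> f i = g i) ->
  holonomy f n = holonomy g n.
Proof.
elim: n => // n IH fg /=.
rewrite IH => [|i /leqW]; last exact: fg.
by rewrite !fg ?leqnSn.
Qed.

Lemma holonomyD f m n :
  holonomy f (m + n) = holonomy f m * holonomy (fun i => f (m + i)%N) n.
Proof.
elim: n => [|n IH] /=; first by rewrite addn0 mulg1.
by rewrite addnS /= IH mulgA.
Qed.

Lemma holonomy_cocycle A f n : cocycle_on A ->
  (forall i, (i <= n)%N -> A (f i)) -> holonomy f n = T (f 0) (f n).
Proof.
move=> cA; elim: n => [|n IH] Af /=; first by rewrite (cocycle_refl cA) //; exact: Af.
rewrite IH => [|i /leqW]; last exact: Af.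
by apply: cA; apply: Af; rewrite ?leqnSn.
Qed.

(** Inside each coarse step the finer product telescopes, since all its points lie in one cocycle
    set. *)
Lemma holonomy_refine f n k :
  (forall i, (i < n)%N -> exists2 A, cocycle_on A &
     forall j, (j <= k)%N -> A (f (i * k + j)%N)) ->
  holonomy f (n * k) = holonomy (fun i => f (i * k)%N) n.
Proof.
elim: n => [|n IH] fA /=; first by [].
rewrite mulSn addnC holonomyD IH => [|i /leqW]; last exact: fA.
congr (_ * _).
have [A cA Af] := fA n (leqnn _).
by rewrite (holonomy_cocycle cA Af) addn0 addnC.
Qed.

(** The chains are the rails of a ladder with rungs [T (f i) (g i)]; each square lies in one cocycle
    set, so a rung can be pushed past it. *)
Lemma holonomy_ladder f g n :
  (forall i, (i < n)%N -> exists2 A, cocycle_on A &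
     [/\ A (f i), A (f i.+1), A (g i) & A (g i.+1)]) ->
  T (f 0) (g 0) * holonomy g n = holonomy f n * T (f n) (g n).
Proof.
elim: n => [|n IH] fg /=; first by rewrite mulg1 mul1g.
have [A cA [f0 f1 g0 g1]] := fg n (leqnn _).
rewrite mulgA IH => [|i /leqW]; last exact: fg.
by rewrite -!mulgA (cA _ _ _ f0 g0 g1) (cA _ _ _ f0 f1 g1).
Qed.

End local_cocycle.

Section cocycle_morphism.
Variables (R : realType) (X : topologicalType) (Q : groupType).
Variable T : X -> X -> Q.
Hypothesis T_local : forall x : X, exists2 U : set X, nbhs x U & cocycle_on T U.
Local Notation I := (unitI R).
Local Notation path x y := {path I from x to y in X}.

(** The Lebesgue number lemma on the unit square, for the cover by preimages of cocycle sets. *)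
Lemma lebesgue_cocycle (F : R * R -> X) : continuous F ->
  \forall N \near \oo, forall z : R * R, (`[0%R, 1%R] `*` `[0%R, 1%R]) z ->
    cocycle_on T (F @` ball z N.+1%:R^-1).
Proof.
move=> cF.
have /compact_near_coveringP : compact (`[0%R, 1%R] `*` `[0%R, 1%R] : set (R * R)).
  by apply: compact_setX; apply: segment_compact.
apply=> z _.
have [U nU cU] := T_local (F z).
have /nbhs_ballP[e /= e0 eU] : nbhs z (F @^-1` U) by apply: cF.
have e2 : 0 < e / 2 by rewrite divr_gt0.
exists (ball z (e / 2), [set N | N.+1%:R^-1 < e / 2]).
  split => /=; first exact: nbhsx_ballx.
  exact: (near_infty_natSinv_lt (PosNum e2)).
move=> [z' N] [/= zz' Ne]; apply: cocycle_onS cU => _ [w zw <-].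
apply: eU; apply: (@ball_split _ _ z') => //.
exact: le_ball (ltW Ne) _ zw.
Qed.

Definition node (p : I -> X) (N i : nat) : X := p (clamp (i%:R / N%:R)).

(** Regular subdivisions are enough: [N] and [M] parts have the common refinement into [N * M]
    parts, so transports can be compared there. *)
Definition adapted (p : I -> X) (N : nat) : Prop :=
  forall i, (i < N)%N -> exists2 A, cocycle_on T A &
    forall r : R, i%:R / N%:R <= r <= i.+1%:R / N%:R -> A (p (clamp r)).

Definition transport (p : I -> X) (N : nat) : Q := holonomy T (node p N) N.

Lemma frac_le (a b N M : nat) : (0 < N)%N -> (0 < M)%N ->
  (a%:R / N%:R <= b%:R / M%:R :> R) = (a * M <= b * N)%N.
Proof.
move=> N0 M0; rewrite ler_pdivrMr ?ltr0n // mulrAC ler_pdivlMr ?ltr0n //.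
by rewrite -!natrM ler_nat.
Qed.

Lemma adaptedM p N k : (0 < N)%N -> (0 < k)%N -> adapted p N -> adapted p (N * k).
Proof.
move=> N0 k0 fp i iNk.
have iN : (i %/ k < N)%N by rewrite ltn_divLR.
have [A cA Ap] := fp _ iN; exists A => // r /andP[r0 r1]; apply: Ap.
apply/andP; split.
  apply: le_trans r0; rewrite frac_le ?muln_gt0 ?N0 //.
  by rewrite mulnCA mulnC leq_mul2r leq_trunc_div orbT.
apply: (le_trans r1); rewrite frac_le ?muln_gt0 ?N0 //.
by rewrite mulnC mulnCA leq_mul2l ltn_ceil ?orbT.
Qed.

Lemma transportM p N k : (0 < N)%N -> (0 < k)%N -> adapted p N ->
  transport p (N * k) = transport p N.
Proof.
move=> N0 k0 fp; rewrite /transport holonomy_refine => [|i iN].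
  apply: eq_holonomy => i _; rewrite /node; congr (p (clamp _)).
  by rewrite !natrM -mulf_div divff ?mulr1 // pnatr_eq0 -lt0n.
have [A cA Ap] := fp _ iN; exists A => // j jk; apply: Ap.
rewrite !frac_le ?muln_gt0 ?N0 //; apply/andP; split.
  by rewrite mulnCA mulnC leq_mul2r leq_addr orbT.
by rewrite mulnC mulnCA leq_mul2l mulSn addnC leq_add2r jk orbT.
Qed.

Lemma transport_eq p N M : (0 < N)%N -> (0 < M)%N -> adapted p N -> adapted p M ->
  transport p N = transport p M.
Proof.
by move=> N0 M0 fN fM; rewrite -(transportM N0 M0 fN) mulnC transportM.
Qed.

(** The square is cut into a grid with every box in a cocycle set. Consecutive rows form a ladder
    whose outer rungs are trivial because the homotopy fixes the endpoints. *)
Lemma adapted_homotopy x y (p q : path x y) : path_homotopic p q ->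
  exists2 N, (0 < N)%N &
    [/\ adapted p N, adapted q N & transport p N = transport q N].
Proof.
move=> [H [cH H0 H1 Hx Hy]].
pose F (z : R * R) := H (clamp z.1, clamp z.2).
have cF : continuous F.
  apply: (Defs.ccomp cH); apply: Defs.cpair; apply: Defs.cclamp.
    exact: Defs.cfst.
  exact: Defs.csnd.
have [M _ Mc] := lebesgue_cocycle cF.
have {}Mc : forall z : R * R, (`[0%R, 1%R] `*` `[0%R, 1%R]) z ->
  cocycle_on T (F @` ball z M.+1%:R^-1) by apply: Mc => /=.
(* The balls of radius 1/(M+1) are open, so the mesh 1/N has to be strictly smaller. *)
pose N := M.+2; have N0 : (0 < N)%N by [].
have N0R : 0 < N%:R :> R by rewrite ltr0n.
have box i j : (i < N)%N -> (j < N)%N -> exists2 A, cocycle_on T A &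
    forall s t : R, i%:R / N%:R <= s <= i.+1%:R / N%:R ->
      j%:R / N%:R <= t <= j.+1%:R / N%:R -> A (F (s, t)).
  move=> iN jN; eexists; first apply: (Mc (i%:R / N%:R, j%:R / N%:R)).
    by split; rewrite /= in_itv /= divr_ge0 //= ler_pdivrMr // mul1r ler_nat ltnW.
  have near (k : nat) (r : R) : k%:R / N%:R <= r <= k.+1%:R / N%:R ->
      ball (k%:R / N%:R : R) M.+1%:R^-1 r.
    move=> /andP[r0 r1]; rewrite /ball /= distrC ger0_norm ?subr_ge0 //.
    apply: (@le_lt_trans _ _ N%:R^-1); last by rewrite ltf_pV2 ?posrE ?ltr0n // ltr_nat.
    by rewrite lerBlDl -[X in _ + X]mul1r -mulrDl natr1.
  by move=> s t /near s_ /near t_; exists (s, t).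
have endp (k : nat) (i : nat) : (k <= i <= k.+1)%N ->
    k%:R / N%:R <= (i%:R / N%:R : R) <= k.+1%:R / N%:R.
  by move=> /andP[? ?]; rewrite !frac_le // !leq_mul2r /= andbC; apply/andP.
have F0 t : F (t, 0) = p (clamp t).
  by rewrite /F /= -H0.
have F1 t : F (t, 1) = q (clamp t).
  by rewrite /F /= -H1.
have Fx t : F (0, t) = x by rewrite /F /= -(Hx (clamp t)).
have Fy t : F (1, t) = y by rewrite /F /= -(Hy (clamp t)).
exists N => //; split.
- move=> i iN; have [A cA AF] := box i 0 iN isT; exists A => // r ri.
  by rewrite -F0; apply: AF => //; rewrite mul0r lexx divr_ge0.
- move=> i iN; have [A cA AF] := box i M.+1 iN (leqnn _); exists A => // r ri.
  rewrite -F1; apply: AF => //; rewrite divff ?gt_eqF // lexx.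
  by rewrite ler_pdivrMr // mul1r ler_nat andbT.
pose row j (i : nat) := F (i%:R / N%:R, j%:R / N%:R).
have rowE j : (j <= N)%N -> holonomy T (row 0) N = holonomy T (row j) N.
  elim: j => // j IH jN; rewrite IH ?(ltnW jN) //.
  have := @holonomy_ladder X Q T (row j) (row j.+1) N.
  rewrite /row !mul0r divff ?gt_eqF // !Fx !Fy.
  have [U nU cU] := T_local x; rewrite (cocycle_refl cU); last exact: nbhs_singleton.
  have [V nV cV] := T_local y; rewrite (cocycle_refl cV); last exact: nbhs_singleton.
  rewrite mul1g mulg1 => -> // i iN.
  have [A cA AF] := box i j iN jN; exists A => //.
  by split; apply: AF; apply: endp; rewrite ?leqnn ?leqnSn.
have := rowE N (leqnn _); rewrite /row /transport mul0r divff ?gt_eqF //.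
rewrite (@eq_holonomy _ _ _ _ (node p N)) => [->|i _]; last exact: F0.
by apply: eq_holonomy => i _; exact: F1.
Qed.

Lemma adapted_exists x y (p : path x y) : exists2 N, (0 < N)%N & adapted p N.
Proof.
by have [N N0 []] := adapted_homotopy (path_homotopic_refl p); exists N.
Qed.

(** A relation, because no number of parts is canonical; compactness makes it total and common
    refinement makes it functional. *)
Definition carries x y (p : path x y) (a : Q) : Prop :=
  exists N, [/\ (0 < N)%N, adapted p N & transport p N = a].

Lemma carries_exists x y (p : path x y) : exists a, carries p a.
Proof. by have [N N0 fp] := adapted_exists p; exists (transport p N), N. Qed.

Lemma carries_unique x y (p : path x y) a b :
  carries p a -> carries p b -> a = b.
Proof.
by move=> [N [N0 fN <-]] [M [M0 fM <-]]; exact: transport_eq.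
Qed.

Lemma carries_homotopic x y (p q : path x y) a :
  path_homotopic p q -> carries p a -> carries q a.
Proof.
move=> /adapted_homotopy[N N0 [fp fq pq]] [M [M0 fM <-]].
by exists N; split=> //; rewrite -pq; exact: transport_eq.
Qed.

Lemma carries_cocycle x y (p : path x y) (A : set X) :
  cocycle_on T A -> (forall t, A (p t)) -> carries p (T x y).
Proof.
move=> cA Ap; exists 1%N; split=> //; first by move=> i _; exists A.
have fp : (p zero = x) * (p one = y) by split; [exact: path_zero|exact: path_one].
rewrite /transport (holonomy_cocycle cA) => [|i _]; last exact: Ap.
by rewrite /node mul0r divr1 -[clamp 0]/zero -[clamp 1]/one !fp.
Qed.

Lemma carries_cocycle2 x y (p : path x y) (A B : set X) :
  cocycle_on T A -> cocycle_on T B ->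
  (forall r : R, 0 <= r <= 2^-1 -> A (p (clamp r))) ->
  (forall r : R, 2^-1 <= r <= 1 -> B (p (clamp r))) ->
  carries p (T x (p (clamp 2^-1)) * T (p (clamp 2^-1)) y)%g.
Proof.
move=> cA cB Ap Bp; exists 2%N; split=> //.
  case=> [|[|]] // _; [exists A|exists B] => // r r01; [apply: Ap|apply: Bp];
    move: r01; rewrite ?mul0r ?mul1r ?divff ?pnatr_eq0 //.
have p0 : p zero = x by exact: path_zero.
have p1 : p one = y by exact: path_one.
rewrite /transport /= /node mul0r mul1r divff ?pnatr_eq0 // mul1g.
by rewrite -[clamp 0]/zero -[clamp 1]/one p0 p1.
Qed.

Lemma carries_concat x y z (p : path x y) (q : path y z) a b :
  carries p a -> carries q b -> carries (path_concat p q) (a * b)%g.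
Proof.
move=> [N [N0 fN <-]] [M [M0 fM <-]].
(* Both paths are cut into the same number of parts, so that the cuts of the concatenation are again
   regular. *)
have fp := adaptedM N0 M0 fN; have := adaptedM M0 N0 fM; rewrite mulnC => fq.
rewrite -(transportM N0 M0 fN) -(transportM M0 N0 fM) [(M * N)%N]mulnC.
move: (N * M)%N fp fq (muln_gt0 N M); rewrite N0 M0 => K fp fq K0.
have KR : 0 < K%:R :> R by rewrite ltr0n.
have half (i : nat) : i%:R / (K + K)%:R = i%:R / K%:R / 2 :> R.
  by rewrite addnn -muln2 natrM invfM mulrA.
have halfr (i : nat) : (K + i)%:R / (K + K)%:R = 2^-1 + i%:R / K%:R / 2 :> R.
  by rewrite half natrD mulrDl divff ?gt_eqF // mulrDl mul1r.
have bnd (i : nat) : (i <= K)%N -> 0 <= (i%:R / K%:R : R) <= 1.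
  by move=> iK; rewrite divr_ge0 //= ler_pdivrMr // mul1r ler_nat.
have nodel i : (i <= K)%N -> node (path_concat p q) (K + K) i = node p K i.
  move=> /bnd iK; rewrite /node half Defs.concat_l; last by lra.
  by congr (p (clamp _)); lra.
have noder i : (i <= K)%N ->
    node (path_concat p q) (K + K) (K + i) = node q K i.
  move=> /bnd iK; rewrite /node halfr Defs.concat_r; last by lra.
  by congr (q (clamp _)); lra.
exists (K + K)%N; split; first by rewrite addn_gt0 K0.
- move=> i iKK; case: (ltnP i K) => iK.
    have [A cA Ap] := fp i iK; exists A => // r; rewrite !half => r01.
    have := bnd _ (ltnW iK); have := bnd _ iK => ? ?.
    by rewrite Defs.concat_l; [apply: Ap; lra|lra].
  have [j jK ->] : exists2 j, (j < K)%N & i = (K + j)%N.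
    by exists (i - K)%N; rewrite ?subnKC // ltn_subLR.
  have [A cA Ap] := fq j jK; exists A => // r; rewrite -addnS !halfr => r01.
  have := bnd _ (ltnW jK); have := bnd _ jK => ? ?.
  by rewrite Defs.concat_r; [apply: Ap; lra|lra].
rewrite /transport holonomyD; congr (_ * _)%g.
  exact: eq_holonomy.
by apply: eq_holonomy => i /noder.
Qed.

Section group_morphism.
Variable x : X.
Local Open Scope quotient_scope.

Definition pi1_transport (c : fundamental_group R x) : Q :=
  xget 1%g (carries (repr c)).

Lemma pi1_transportE (p : path x x) a :
  carries p a -> pi1_transport (\pi_(fundamental_group R x) p) = a.
Proof.
move=> pa; rewrite /pi1_transport.
have /path_homotopic_sym hp : path_homotopic (repr (\pi_(fundamental_group R x) p)) p.
  by apply/loop_classP; rewrite reprK.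
have ra := carries_homotopic hp pa.
exact: carries_unique (xgetI _ ra) ra.
Qed.

Lemma pi1_transportM :
  {morph pi1_transport : c d / (c * d)%g >-> (c * d)%g}.
Proof.
elim/quotW=> p; elim/quotW=> q; rewrite -[(_ * _)%g]/(pi1_mul _ _) pi1_mulE.
have [a pa] := carries_exists p; have [b qb] := carries_exists q.
rewrite (pi1_transportE (carries_concat pa qb)).
by rewrite (pi1_transportE pa) (pi1_transportE qb).
Qed.

HB.instance Definition _ := isMultiplicative.Build (fundamental_group R x) Q
  pi1_transport pi1_transportM.

Lemma transport_morphism :
  exists phi : {multiplicative fundamental_group R x -> Q},
    forall (p : path x x) a, carries p a ->
      phi (\pi_(fundamental_group R x) p) = a.
Proof. by exists pi1_transport => p a; exact: pi1_transportE. Qed.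

End group_morphism.
End cocycle_morphism.

(** * Lifting a representation of a free group *)

Section wreath_product.
Local Open Scope group_scope.
Variables (H : groupType) (n : nat).

Definition wreath : Type := ({ffun 'I_n -> H} * {perm 'I_n})%type.
HB.instance Definition _ := Choice.on wreath.

Definition wreath_one : wreath := ([ffun=> 1], 1).
(** An element is a permutation whose arrows [i] to [x.2 i] carry labels in [H]; arrows compose from
    left to right, as permutations do here. *)
Definition wreath_mul (x y : wreath) : wreath :=
  ([ffun i => x.1 i * y.1 (x.2 i)], x.2 * y.2).
Definition wreath_inv (x : wreath) : wreath :=
  ([ffun i => (x.1 (x.2^-1 i))^-1], x.2^-1).

Lemma wreath_ext (x y : wreath) :
  x.1 =1 y.1 -> x.2 =1 y.2 -> x = y.
Proof.
by case: x y => [f s] [g t] /= /ffunP -> /permP ->.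
Qed.

Lemma wreath_mulA : associative wreath_mul.
Proof.
move=> x y z; apply: wreath_ext => i /=; first by rewrite !ffunE /= permM mulgA.
by rewrite mulgA.
Qed.

Lemma wreath_mul1 : left_id wreath_one wreath_mul.
Proof.
by move=> x; apply: wreath_ext => i /=; rewrite ?ffunE /= ?perm1 ?mul1g.
Qed.

Lemma wreath_mul1r : right_id wreath_one wreath_mul.
Proof.
by move=> x; apply: wreath_ext => i /=; rewrite ?ffunE /= ?mulg1.
Qed.

Lemma wreath_mulV : left_inverse wreath_one wreath_inv wreath_mul.
Proof.
by move=> x; apply: wreath_ext => i /=; rewrite ?ffunE /= ?mulVg.
Qed.

Lemma wreath_mulVr : right_inverse wreath_one wreath_inv wreath_mul.
Proof.
by move=> x; apply: wreath_ext => i /=; rewrite ?ffunE /= ?permK ?mulgV.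
Qed.

HB.instance Definition _ := isGroup.Build wreath
  wreath_mulA wreath_mul1 wreath_mul1r wreath_mulV wreath_mulVr.

Lemma wreath_mul1E (x y : wreath) i : (x * y).1 i = x.1 i * y.1 (x.2 i).
Proof. by rewrite /mul /= ffunE. Qed.

Lemma wreath_mul2E (x y : wreath) i : (x * y).2 i = y.2 (x.2 i).
Proof. by rewrite /mul /= permM. Qed.

Lemma wreath_inv1E (x : wreath) i j : x.2 j = i -> (x^-1).1 i = (x.1 j)^-1.
Proof. by move=> <-; rewrite /inv /= ffunE permK. Qed.

Lemma wreath_inv2E (x : wreath) i j : x.2 j = i -> (x^-1).2 i = j.
Proof. by move=> <-; rewrite /inv /= permK. Qed.

End wreath_product.

Section wreath_map.
Local Open Scope group_scope.
Variables (H K : groupType) (n : nat) (f : {multiplicative H -> K}).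

Definition wreath_map (x : wreath H n) : wreath K n :=
  ([ffun i => f (x.1 i)], x.2).

Lemma wreath_mapM : {morph wreath_map : x y / x * y}.
Proof.
move=> x y; apply: wreath_ext => i; last by [].
by rewrite !ffunE gmulfM.
Qed.

HB.instance Definition _ :=
  isMultiplicative.Build (wreath H n) (wreath K n) wreath_map wreath_mapM.

Lemma wreath_map_surj :
  (forall k, exists h, f h = k) -> forall y, exists x, wreath_map x = y.
Proof.
move=> /choice[g gK] y; exists ([ffun i => g (y.1 i)], y.2).
by apply: wreath_ext => i //=; rewrite !ffunE gK.
Qed.

End wreath_map.

Section heisenberg.

Definition mulint2 : Type := (int * int)%type.
HB.instance Definition _ := Choice.on mulint2.
Definition mulint2_mul (x y : mulint2) : mulint2 := (x.1 + y.1, x.2 + y.2).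
Definition mulint2_inv (x : mulint2) : mulint2 := (- x.1, - x.2).

Lemma mulint2A : associative mulint2_mul.
Proof. by move=> x y z; rewrite /mulint2_mul !addrA. Qed.

Lemma mulint2_mul1 : left_id ((0, 0) : mulint2) mulint2_mul.
Proof. by move=> [x y]; rewrite /mulint2_mul !add0r. Qed.

Lemma mulint2_mul1r : right_id ((0, 0) : mulint2) mulint2_mul.
Proof. by move=> [x y]; rewrite /mulint2_mul !addr0. Qed.

Lemma mulint2_mulV : left_inverse ((0, 0) : mulint2) mulint2_inv mulint2_mul.
Proof. by move=> [x y]; rewrite /mulint2_mul !addNr. Qed.

Lemma mulint2_mulVr : right_inverse ((0, 0) : mulint2) mulint2_inv mulint2_mul.
Proof. by move=> [x y]; rewrite /mulint2_mul !addrN. Qed.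

HB.instance Definition _ := isGroup.Build mulint2
  mulint2A mulint2_mul1 mulint2_mul1r mulint2_mulV mulint2_mulVr.

(** The Heisenberg group as a central extension of Z^2 by Z, with cocycle [x.1.1 * y.1.2]; the
    commutator of two elements is the determinant of their projections. *)
Definition heis : Type := (mulint2 * int)%type.
HB.instance Definition _ := Choice.on heis.
Definition heis_mul (x y : heis) : heis :=
  (mulint2_mul x.1 y.1, x.2 + y.2 + x.1.1 * y.1.2).
Definition heis_one : heis := ((0, 0), 0).
Definition heis_inv (x : heis) : heis :=
  (mulint2_inv x.1, - x.2 + x.1.1 * x.1.2).

Lemma heis_mulA : associative heis_mul.
Proof.
move=> [[a b] c] [[a' b'] c'] [[a2 b2] c2]; rewrite /heis_mul /mulint2_mul /=.
by congr ((_, _), _); ring.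
Qed.

Lemma heis_mul1 : left_id heis_one heis_mul.
Proof.
move=> [[a b] c]; rewrite /heis_mul /mulint2_mul /=.
by congr ((_, _), _); ring.
Qed.

Lemma heis_mul1r : right_id heis_one heis_mul.
Proof.
move=> [[a b] c]; rewrite /heis_mul /mulint2_mul /=.
by congr ((_, _), _); ring.
Qed.

Lemma heis_mulV : left_inverse heis_one heis_inv heis_mul.
Proof.
move=> [[a b] c]; rewrite /heis_mul /mulint2_mul /=.
by congr ((_, _), _); rewrite /=; ring.
Qed.

Lemma heis_mulVr : right_inverse heis_one heis_inv heis_mul.
Proof.
move=> [[a b] c]; rewrite /heis_mul /mulint2_mul /=.
by congr ((_, _), _); rewrite /=; ring.
Qed.

HB.instance Definition _ := isGroup.Build heis
  heis_mulA heis_mul1 heis_mul1r heis_mulV heis_mulVr.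

Definition heis_proj (x : heis) : mulint2 := x.1.

Lemma heis_projM : {morph heis_proj : x y / (x * y)%g}.
Proof. by []. Qed.

HB.instance Definition _ :=
  isMultiplicative.Build heis mulint2 heis_proj heis_projM.

Lemma heis_commute (x y : heis) :
  (x * y = y * x)%g -> x.1.1 * y.1.2 = y.1.1 * x.1.2.
Proof.
by move=> /(congr1 snd) /=; rewrite [y.2 + x.2]addrC => /addrI.
Qed.

End heisenberg.

Section free_groups.

(** Free groups are projective: the existence half of the universal property gives the lift from
    chosen preimages, and the uniqueness half identifies its projection with [phi]. *)
Lemma free_group_lift (F E Q : groupType) (p : {multiplicative E -> Q})
    (phi : {multiplicative F -> Q}) :
  free_group F -> (forall q, exists e, p e = q) ->
  exists psi : {multiplicative F -> E}, forall x, p (psi x) = phi x.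
Proof.
move=> [S basis] /choice[g gK].
have [psi psiE _] := basis E (fun x => g (phi x)).
have [chi _ chi_uniq] := basis Q phi.
exists psi => x.
have -> := chi_uniq phi (fun _ _ => erefl) x.
rewrite -[LHS]/((p \o psi) x).
by apply: (chi_uniq (p \o psi)) => s Ss /=; rewrite psiE.
Qed.

(* Two elements of the Heisenberg group commute iff their images in Z^2 are
   linearly dependent. *)
Lemma free_group_commute (F : groupType) (n : nat)
    (phi : {multiplicative F -> wreath mulint2 n}) (x y : F) (i : 'I_n) :
  free_group F -> (x * y = y * x)%g ->
  (phi x).2 i = i -> (phi y).2 i = i ->
  ((phi x).1 i).1 * ((phi y).1 i).2 = ((phi y).1 i).1 * ((phi x).1 i).2.
Proof.
move=> freeF xy xi yi.
have [psi psiE] := @free_group_lift F (wreath heis n) (wreath mulint2 n)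
  (wreath_map (n := n) heis_proj) phi freeF
  (wreath_map_surj (n := n) (f := heis_proj) (fun k => ex_intro _ (k, 0) erefl)).
move: xi yi; rewrite -!psiE /wreath_map /= !ffunE => xi yi.
apply: heis_commute.
(* On elements that fix [i] the label at [i] is multiplicative, so the labels of the two lifts
   commute in the Heisenberg group. *)
have : (psi (x * y)%g).1 i = (psi (y * x)%g).1 i by rewrite xy.
by rewrite !gmulfM !wreath_mul1E xi yi.
Qed.

End free_groups.

(** * Polygonal paths in the complement of a set in a normed space *)

Section segment_paths.
Variables (R : realType) (V : normedModType R) (A : set V).
Local Notation X := (set_type A).
Local Notation I := (unitI R).
Local Notation path x y := {path I from x to y in X}.

Definition lerp (t : R) (a b : V) : V := (1 - t) *: a + t *: b.

Lemma lerp0 a b : lerp 0 a b = a.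
Proof. by rewrite /lerp subr0 scale1r scale0r addr0. Qed.

Lemma lerp1 a b : lerp 1 a b = b.
Proof. by rewrite /lerp subrr scale1r scale0r add0r. Qed.

Lemma lerpxx t a : lerp t a a = a.
Proof. by rewrite /lerp -scalerDl subrK scale1r. Qed.

Lemma lerp_continuous (T : topologicalType) (t : T -> R) (a b : T -> V) :
  continuous t -> continuous a -> continuous b ->
  continuous (fun x => lerp (t x) (a x) (b x)).
Proof.
move=> ct ca cb x; apply: cvgD; apply: cvgZ; [|exact: ca|exact: ct|exact: cb].
by apply: cvgB; [exact: cvg_cst|exact: ct].
Qed.

Section corestriction.
Variables (T : topologicalType) (g : T -> V).
Hypotheses (cg : continuous g) (gA : forall t, A (g t)).

Definition corestrict (t : T) : X := exist _ (g t) (mem_set (gA t)).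

Lemma corestrict_continuous : continuous corestrict.
Proof.
by apply/continuousP => _ [U oU <-]; have /continuousP/(_ _ oU) := cg.
Qed.

End corestriction.

Lemma val_continuous : continuous (\val : X -> V).
Proof. exact: (@initial_continuous (set_type _) V). Qed.

Lemma straight_homotopic (x y : X) (p q : path x y) :
  (forall t s, 0 <= s <= 1 -> A (lerp s (\val (p t)) (\val (q t)))) ->
  path_homotopic p q.
Proof.
move=> pqA.
pose g (ts : I * I) := lerp (unitI_val ts.2) (\val (p ts.1)) (\val (q ts.1)).
have gA ts : A (g ts) by apply: pqA; exact: unitI_bounds.
have cg : continuous g.
  apply: lerp_continuous.
  - exact: (Defs.cval (@Defs.csnd _ _)).
  - apply: (Defs.ccomp val_continuous).
    exact: (Defs.ccomp (@Defs.cpath _ _ _ _ p) (@Defs.cfst _ _)).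
  - apply: (Defs.ccomp val_continuous).
    exact: (Defs.ccomp (@Defs.cpath _ _ _ _ q) (@Defs.cfst _ _)).
have [p0 q0] : p zero = x /\ q zero = x by split; exact: path_zero.
have [p1 q1] : p one = y /\ q one = y by split; exact: path_one.
exists (corestrict gA); split.
- exact: corestrict_continuous.
- by move=> t; apply: val_inj; rewrite /= /g Defs.zeroE lerp0.
- by move=> t; apply: val_inj; rewrite /= /g Defs.oneE lerp1.
- by move=> s; apply: val_inj; rewrite /= /g /= p0 q0 lerpxx.
- by move=> s; apply: val_inj; rewrite /= /g /= p1 q1 lerpxx.
Qed.

Section segment_path.
Variables x y : X.
Hypothesis xyA : forall t, 0 <= t <= 1 -> A (lerp t (\val x) (\val y)).

Let g (t : I) : V := lerp (unitI_val t) (\val x) (\val y).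

Let gA t : A (g t). Proof. by apply: xyA; exact: unitI_bounds. Qed.

Let cg : continuous g.
Proof.
apply: lerp_continuous; first exact: unitI_val_continuous.
  exact: cst_continuous.
exact: cst_continuous.
Qed.

Let g0 : corestrict gA zero = x.
Proof. by apply: val_inj; rewrite /= /g Defs.zeroE lerp0. Qed.

Let g1 : corestrict gA one = y.
Proof. by apply: val_inj; rewrite /= /g Defs.oneE lerp1. Qed.

Definition segment_path : path x y :=
  mk_path (@corestrict_continuous _ _ cg gA) g0 g1.

Lemma segment_pathE t :
  \val (segment_path t) = lerp (unitI_val t) (\val x) (\val y).
Proof. by []. Qed.

End segment_path.

Definition hull (P : seq V) : set V :=
  [set v | exists k : 'I_(size P) -> R, [/\ forall i, 0 <= k i,
     \sum_i k i = 1 & v = \sum_i k i *: P`_i]].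

Lemma hull_lerp (P : seq V) s u v : 0 <= s <= 1 ->
  hull P u -> hull P v -> hull P (lerp s u v).
Proof.
move=> /andP[s0 s1] [k [k0 k1 ->]] [l [l0 l1 ->]].
exists (fun i => (1 - s) * k i + s * l i); split.
- by move=> i; rewrite addr_ge0 // mulr_ge0 // subr_ge0.
- by rewrite big_split /= -!mulr_sumr k1 l1 !mulr1 subrK.
rewrite /lerp !scaler_sumr -big_split; apply: eq_bigr => i _ /=.
by rewrite [RHS]scalerDl !scalerA.
Qed.

Lemma hull_mem (P : seq V) v : v \in P -> hull P v.
Proof.
move=> vP; have iP : (index v P < size P)%N by rewrite index_mem.
exists (fun i => (i == Ordinal iP)%:R); split.
- by move=> i; rewrite ler0n.
- by rewrite (bigD1 (Ordinal iP)) //= eqxx big1 ?addr0 // => i /negPf ->.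
rewrite (bigD1 (Ordinal iP)) //= eqxx big1 => [|i /negPf ->]; last by rewrite scale0r.
by rewrite scale1r addr0 nth_index.
Qed.

Section quadrilateral.
Variables (x y z w : X).
Hypothesis hullA : hull [:: \val x; \val y; \val z; \val w] `<=` A.
Variables (p : path x y) (q : path y w) (p' : path x z) (q' : path z w).
Hypotheses (pE : forall t, \val (p t) = lerp (unitI_val t) (\val x) (\val y))
  (qE : forall t, \val (q t) = lerp (unitI_val t) (\val y) (\val w))
  (p'E : forall t, \val (p' t) = lerp (unitI_val t) (\val x) (\val z))
  (q'E : forall t, \val (q' t) = lerp (unitI_val t) (\val z) (\val w)).

(** Both broken lines stay in the convex hull of the corners, hence so does the straight-line
    homotopy between them. The corners may span a tetrahedron. *)
Lemma quadrilateral_homotopic :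
  path_homotopic (path_concat p q) (path_concat p' q').
Proof.
have mem v : v \in [:: \val x; \val y; \val z; \val w] ->
  hull [:: \val x; \val y; \val z; \val w] v by exact: hull_mem.
have [hx hy hz hw] : [/\ hull [:: \val x; \val y; \val z; \val w] (\val x),
    hull [:: \val x; \val y; \val z; \val w] (\val y),
    hull [:: \val x; \val y; \val z; \val w] (\val z) &
    hull [:: \val x; \val y; \val z; \val w] (\val w)].
  by split; apply: mem; rewrite !inE eqxx ?orbT.
apply: straight_homotopic => t s s01; apply: hullA; apply: hull_lerp => //.
  rewrite -[path_concat p q t]/(path_concat_fun p q t) /path_concat_fun.
  by case: ifP => _; rewrite ?pE ?qE; apply: hull_lerp => //; exact: unitI_bounds.
rewrite -[path_concat p' q' t]/(path_concat_fun p' q' t) /path_concat_fun.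
by case: ifP => _; rewrite ?p'E ?q'E; apply: hull_lerp => //; exact: unitI_bounds.
Qed.

End quadrilateral.

Section tube.

Definition side_in (x y : nat -> X) : Prop := forall i,
  hull [:: \val (x i); \val (y i); \val (x i.+1); \val (y i.+1)] `<=` A.

Variables (a b c : nat -> X).
Hypotheses (abA : side_in a b) (bcA : side_in b c) (caA : side_in c a).

Lemma tube_across (x y : nat -> X) :
  side_in x y -> forall i t, 0 <= t <= 1 -> A (lerp t (\val (x i)) (\val (y i))).
Proof.
move=> xyA i t t01; apply: (xyA i); apply: hull_lerp => //; apply: hull_mem.
  by rewrite !inE eqxx.
by rewrite !inE eqxx orbT.
Qed.

Lemma tube_along (x y : nat -> X) :
  side_in x y -> forall i t, 0 <= t <= 1 -> A (lerp t (\val (x i)) (\val (x i.+1))).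
Proof.
move=> xyA i t t01; apply: (xyA i); apply: hull_lerp => //; apply: hull_mem.
  by rewrite !inE eqxx.
by rewrite !inE eqxx !orbT.
Qed.

Let ab i : path (a i) (b i) := segment_path (@tube_across a b abA i).
Let bc i : path (b i) (c i) := segment_path (@tube_across b c bcA i).
Let ca i : path (c i) (a i) := segment_path (@tube_across c a caA i).

Definition meridian i : path (a i) (a i) :=
  path_concat (path_concat (ab i) (bc i)) (ca i).

Definition longitude_step i : path (a i) (a i.+1) :=
  segment_path (@tube_along a b abA i).

Fixpoint longitude n : path (a 0) (a n) :=
  if n is m.+1 return path (a 0) (a n)
  then path_concat (longitude m) (longitude_step m)
  else path_const R (a 0).

(** The step along the tube is moved leftwards across the sides [ca], [bc] and [ab], by one
    quadrilateral each; the rest is reassociation. *)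
Lemma meridian_step i :
  path_homotopic (path_concat (meridian i) (longitude_step i))
                 (path_concat (longitude_step i) (meridian i.+1)).
Proof.
pose lb i : path (b i) (b i.+1) := segment_path (@tube_along b c bcA i).
pose lc i : path (c i) (c i.+1) := segment_path (@tube_along c a caA i).
have qa : path_homotopic (path_concat (ab i) (lb i))
    (path_concat (longitude_step i) (ab i.+1)).
  by apply: (quadrilateral_homotopic (@abA i)).
have qb : path_homotopic (path_concat (bc i) (lc i))
    (path_concat (lb i) (bc i.+1)).
  by apply: (quadrilateral_homotopic (@bcA i)).
have qc : path_homotopic (path_concat (ca i) (longitude_step i))
    (path_concat (lc i) (ca i.+1)).
  by apply: (quadrilateral_homotopic (@caA i)).
apply: path_homotopic_trans (path_homotopic_sym (path_concatA _ _ _)) _.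
apply: path_homotopic_trans (path_homotopic_concat (path_homotopic_refl _) qc) _.
apply: path_homotopic_trans (path_concatA _ _ _) _.
apply: path_homotopic_trans (path_homotopic_sym (path_concatA _ _ _)).
apply: path_homotopic_concat (path_homotopic_refl _).
apply: path_homotopic_trans (path_homotopic_sym (path_concatA _ _ _)) _.
apply: path_homotopic_trans (path_homotopic_concat (path_homotopic_refl _) qb) _.
apply: path_homotopic_trans (path_concatA _ _ _) _.
apply: path_homotopic_trans (path_homotopic_sym (path_concatA _ _ _)).
apply: path_homotopic_concat (path_homotopic_refl _).
exact: qa.
Qed.

Lemma meridian_longitude n :
  path_homotopic (path_concat (meridian 0) (longitude n))
                 (path_concat (longitude n) (meridian n)).
Proof.
elim: n => [|n IH] /=.
  apply: path_homotopic_trans (path_concat_const_r _) _.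
  exact: path_homotopic_sym (path_concat_const_l _).
apply: path_homotopic_trans (path_concatA _ _ _) _.
apply: path_homotopic_trans (path_homotopic_concat IH (path_homotopic_refl _)) _.
apply: path_homotopic_trans (path_homotopic_sym (path_concatA _ _ _)) _.
apply: path_homotopic_trans (path_concatA _ _ _).
exact: path_homotopic_concat (path_homotopic_refl _) (meridian_step n).
Qed.

End tube.
End segment_paths.

(** * Straight-line drawings of graphs *)

Lemma sum_scale_continuous (R : realType) (T : topologicalType)
    (V : normedModType R) (k : T -> R) (v : V) (f : T -> V) :
  continuous k -> continuous f -> continuous (fun x => k x *: v + f x).
Proof.
move=> ck cf x; apply: cvgD; last exact: cf.
by apply: cvgZ; [exact: ck|exact: cvg_cst].
Qed.

Section straight_line_drawing.
Variables (R : realType) (G : sgraph) (p : G -> 'rV[R]_3).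
Local Notation e := (@vertex_pt R G).

(* The degenerate cell (u, u) is the vertex u. *)
Definition cell (u v : G) : bool := (u == v) || adj u v.

(** The conclusion compares points of the realization instead of indices and parameters, since a
    vertex has a description in each cell that contains it. *)
Definition cell_injective : Prop := forall u v u' v' t s,
  cell u v -> cell u' v' -> 0 <= t <= 1 -> 0 <= s <= 1 ->
  lerp t (p u) (p v) = lerp s (p u') (p v') ->
  lerp t (e u) (e v) = lerp s (e u') (e v').

Definition draw (x : 'rV[R]_#|G|) : 'rV[R]_3 :=
  \sum_(v : G) x ord0 (enum_rank v) *: p v.

Lemma draw_vertex v : draw (e v) = p v.
Proof.
rewrite /draw (bigD1 v) //= mxE !eqxx scale1r big1 ?addr0 // => u uv.
by rewrite mxE eqxx (inj_eq enum_rank_inj) (negPf uv) scale0r.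
Qed.

Lemma draw_lerp t a b : draw (lerp t a b) = lerp t (draw a) (draw b).
Proof.
rewrite /draw /lerp !scaler_sumr -big_split; apply: eq_bigr => v _ /=.
by rewrite !mxE [LHS]scalerDl !scalerA.
Qed.

Lemma draw_continuous : continuous draw.
Proof.
rewrite /draw; elim: (index_enum _) => [|v s IH].
  under eq_fun do rewrite big_nil.
  exact: cst_continuous.
under eq_fun do rewrite big_cons.
apply: sum_scale_continuous IH => x; exact: coord_continuous.
Qed.

Definition drawing (x : realization R G) : 'rV[R]_3 := draw (\val x).

Lemma realization_cell (x : realization R G) :
  exists u v t, [/\ cell u v, 0 <= t <= 1 & \val x = lerp t (e u) (e v)].
Proof.
have xr : @realization_set R G (\val x) by exact: set_valP.
case: xr => [[v _ vx]|[u [v [uv [t t01 tx]]]]].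
  exists v, v, 0; rewrite /cell eqxx lexx ler01; split=> //.
  by rewrite lerp0 vx.
by exists u, v, t; rewrite /cell uv orbT.
Qed.

Lemma cell_realization u v t : cell u v -> 0 <= t <= 1 ->
  @realization_set R G (lerp t (e u) (e v)).
Proof.
case/orP => [/eqP <- _|uv t01].
  by left; exists u => //; rewrite lerpxx.
by right; exists u, v; split=> //; exists t => //=; rewrite in_itv.
Qed.

Definition realization_pt (x : 'rV[R]_#|G|) (h : @realization_set R G x) :
  realization R G := exist (fun y => y \in @realization_set R G) x (mem_set h).

Lemma drawing_continuous : continuous drawing.
Proof.
apply: Defs.ccomp; first exact: draw_continuous.
exact: val_continuous.
Qed.

Lemma realization_compact : compact [set: realization R G].
Proof.
pose F (uv : G * G) : set (realization R G) :=
  [set x | exists2 t, 0 <= t <= 1 & \val x = lerp t (e uv.1) (e uv.2)].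
have -> : [set: realization R G] =
    \big[setU/set0]_(uv <- index_enum (G * G)%type | cell uv.1 uv.2) F uv.
  apply/seteqP; split=> // x _; rewrite -bigcup_seq_cond.
  have [u [v [t [uv t01 xE]]]] := realization_cell x.
  by exists (u, v); [rewrite /= mem_index_enum|exists t].
apply: bigsetU_compact => -[u v] /= uv.
have gA (r : R) : @realization_set R G (lerp (unitI_val (clamp r)) (e u) (e v)).
  by apply: cell_realization => //; exact: unitI_bounds.
have cg : continuous (fun r : R => lerp (unitI_val (clamp r)) (e u) (e v)).
  apply: lerp_continuous; [|exact: cst_continuous|exact: cst_continuous].
  exact: (Defs.ccomp (@unitI_val_continuous R) (@clamp_continuous R)).
have -> : F (u, v) = corestrict gA @` `[0, 1].
  apply/seteqP; split=> x /=.
    move=> [t t01 xE]; exists t; first by rewrite /= in_itv.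
    by apply: val_inj; rewrite /= clampK.
  move=> [t]; rewrite /= in_itv /= => t01 <-.
  by exists t => //=; rewrite clampK.
apply: continuous_compact; last exact: segment_compact.
by apply: continuous_subspaceT; apply: corestrict_continuous.
Qed.

Hypothesis p_inj : cell_injective.

Lemma drawing_inj : injective drawing.
Proof.
move=> x y; have [u [v [t [uv t01 xE]]]] := realization_cell x.
have [u' [v' [s [uv' s01 yE]]]] := realization_cell y.
rewrite /drawing xE yE !draw_lerp !draw_vertex => xy.
by apply: val_inj; rewrite /= xE yE; exact: p_inj.
Qed.

(** A continuous injection of a compact space into a Hausdorff space: the image of an open set is
    cut out by the complement of a compact image. *)
Lemma drawing_embedding : embedding drawing.
Proof.
split; [exact: drawing_continuous|exact: drawing_inj|] => U oU.
apply/open_subspaceP; exists (~` (drawing @` (~` U))).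
  apply: closed_openC; apply: compact_closed; first exact: norm_hausdorff.
  apply: continuous_compact.
    by apply: continuous_subspaceT; exact: drawing_continuous.
  apply: (@subclosed_compact _ _ [set: realization R G]) => //.
    exact: open_closedC.
  exact: realization_compact.
apply/seteqP; split=> y [yU [x _ xE]]; (split; last by exists x).
  exists x => //; apply: contrapT => Ux.
  by apply: yU; exists x.
move=> [z Uz zy]; case: yU => w Uw wy.
by apply: Uz; rewrite (drawing_inj (etrans zy (esym wy))).
Qed.

Lemma drawing_linear : linear_embedding drawing.
Proof.
split; first exact: drawing_embedding.
move=> u v uv; exists (p u), (p v); apply/seteqP; split=> y.
  move=> [x [t t01 xE] <-]; exists t => //.
  by rewrite /drawing -xE -[LHS]/(lerp t (p u) (p v)) -!draw_vertex -draw_lerp.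
move=> [t t01 <-].
have uvt : @realization_set R G (lerp t (e u) (e v)).
  by apply: cell_realization; rewrite /cell ?uv ?orbT //; move: t01; rewrite /= in_itv.
exists (realization_pt uvt); first by exists t.
by rewrite /drawing /= draw_lerp !draw_vertex.
Qed.

Lemma range_drawing y : range drawing y ->
  exists u v t, [/\ cell u v, 0 <= t <= 1 & y = lerp t (p u) (p v)].
Proof.
move=> [x _ <-]; have [u [v [t [uv t01 xE]]]] := realization_cell x.
by exists u, v, t; rewrite /drawing xE draw_lerp !draw_vertex.
Qed.

Lemma cell_range u v t : cell u v -> 0 <= t <= 1 ->
  range drawing (lerp t (p u) (p v)).
Proof.
move=> uv t01; exists (realization_pt (cell_realization uv t01)) => //.
by rewrite /drawing /= draw_lerp !draw_vertex.
Qed.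

End straight_line_drawing.

(** * Moving vertices into general position *)

Section generic_position.
Variables (R : realType) (G : sgraph).
Local Notation e := (@vertex_pt R G).
Implicit Types (D : pred G) (p : G -> 'rV[R]_3).

Definition cell_injective_on D p : Prop := forall u v u' v' (t s : R),
  D u -> D v -> D u' -> D v' -> cell u v -> cell u' v' ->
  0 <= t <= 1 -> 0 <= s <= 1 ->
  lerp t (p u) (p v) = lerp s (p u') (p v') ->
  lerp t (e u) (e v) = lerp s (e u') (e v').

Lemma lerp_swap (V : normedModType R) t (a b : V) : lerp t a b = lerp (1 - t) b a.
Proof. by rewrite /lerp opprB addrCA subrr addr0 addrC. Qed.

(** Quantifying over [f] makes one parameter serve both the drawing and the realization. In the
    second case [a] is any vertex of [D], so the vertex [w] itself is the far end of the segment
    from [a0]. *)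
Lemma cell_split D w a0 u v (t : R) : D a0 -> D u || (u == w) -> D v || (v == w) ->
  cell u v -> 0 <= t <= 1 ->
  (exists (u' v' : G) (s : R), [/\ D u', D v', cell u' v', 0 <= s <= 1 &
     forall (V : normedModType R) (f : G -> V),
       lerp t (f u) (f v) = lerp s (f u') (f v')]) \/
  (exists (a : G) (s : R), [/\ D a, s != 0 &
     forall (V : normedModType R) (f : G -> V),
       lerp t (f u) (f v) = lerp s (f a) (f w)]).
Proof.
move=> Da0 + + uv t01.
have cellxx (x : G) : cell x x by rewrite /cell eqxx.
case/orP => [Du|/eqP uw]; case/orP => [Dv|/eqP vw].
- by left; exists u, v, t.
- have [t0|t0] := eqVneq t 0.
    left; exists u, u, t; split=> // V f; by rewrite t0 !lerp0.
  by right; exists u, t; split=> // V f; rewrite vw.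
- have [t1|t1] := eqVneq t 1.
    left; exists v, v, t; split=> // V f; by rewrite t1 !lerp1.
  right; exists v, (1 - t); split=> //; first by rewrite subr_eq0 eq_sym.
  by move=> V f; rewrite uw lerp_swap.
- right; exists a0, 1; split=> [//||V f]; first by rewrite oner_eq0.
  by rewrite uw vw lerpxx lerp1.
Qed.

(** The form [l] describes a plane through three old points that misses the new one. A segment from
    an old point to [w] meets that plane only at its old end, hence meets no old cell elsewhere. *)
Lemma cell_injective_add D p w a0 : D a0 -> cell_injective_on D p ->
  (forall a b c, D a -> D b -> D c -> exists l : 'rV[R]_3 -> R,
     [/\ forall (t : R) x y, l (lerp t x y) = (1 - t) * l x + t * l y,
         l (p a) = l (p b), l (p b) = l (p c) & l (p w) != l (p a)]) ->
  cell_injective_on [pred v | D v || (v == w)] p.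
Proof.
move=> Da0 inj gen u v u' v' t s Du Dv Du' Dv' uv uv' t01 s01.
have mixed (a b c : G) (r q : R) : D a -> D b -> D c -> r != 0 ->
    lerp r (p a) (p w) != lerp q (p b) (p c).
  move=> Da Db Dc r0; apply/eqP.
  have [l [ll ab bc wa]] := gen a b c Da Db Dc.
  move=> /(congr1 l); rewrite !ll ab bc.
  have -> : (1 - q) * l (p c) + q * l (p c) = l (p c) by rewrite -mulrDl subrK mul1r.
  move=> h; have /eqP : r * (l (p w) - l (p c)) = 0 by lra.
  by rewrite mulf_eq0 (negPf r0) subr_eq0 -bc -ab (negPf wa).
case: (cell_split Da0 Du Dv uv t01) =>
  [[u1 [v1 [t1 [Du1 Dv1 uv1 t101 E1]]]]|[a [t1 [Da t10 E1]]]];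
case: (cell_split Da0 Du' Dv' uv' s01) =>
  [[u2 [v2 [s1 [Du2 Dv2 uv2 s101 E2]]]]|[b [s1 [Db s10 E2]]]];
rewrite !E1 !E2.
- exact: inj.
- by move/eqP; rewrite eq_sym (negPf (mixed _ _ _ _ _ _ _ _ _)).
- by move/eqP; rewrite (negPf (mixed _ _ _ _ _ _ _ _ _)).
move=> ab.
(* Two new segments that meet do so at equal parameters, because [l] agrees at their old ends;
   either both points are [w], or the old ends coincide. *)
have [l [ll lab _ wa]] := gen a b b Da Db Db.
have ts : t1 = s1.
  have := congr1 l ab; rewrite !ll -lab => h.
  have /eqP : (t1 - s1) * (l (p w) - l (p a)) = 0 by lra.
  by rewrite mulf_eq0 [_ - l _ == 0]subr_eq0 (negPf wa) orbF subr_eq0 => /eqP.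
move: ab; rewrite -ts; have [->|t11] := eqVneq t1 1; first by rewrite !lerp1.
rewrite /lerp => /addIr /(scalerI _) pab.
have {}pab : p a = p b by apply: pab; rewrite subr_eq0 eq_sym.
have cellxx (x : G) : cell x x by rewrite /cell eqxx.
have := inj a a b b 0 0 Da Da Db Db (cellxx a) (cellxx b).
by rewrite !lerp0 lexx ler01 => /(_ isT isT pab) ->.
Qed.

(** Two difference vectors have rank at most 2 < 3, so they have a common normal, even when the
    points are collinear or repeated. *)
Lemma common_plane (a b c : 'rV[R]_3) : exists2 u : 'rV[R]_3, u != 0 &
  (a *m u^T = b *m u^T) /\ (b *m u^T = c *m u^T).
Proof.
pose M : 'M[R]_(3, 1 + 1) := row_mx (a - b)^T (b - c)^T.
have kM : kermx M != 0.
  rewrite -mxrank_eq0 mxrank_ker -lt0n subn_gt0.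
  by apply: leq_ltn_trans (rank_leq_col M) _.
have [u /sub_kermxP uM u0] := rowV0Pn kM.
exists u => //; move: uM; rewrite /M mul_mx_row => /eqP.
rewrite row_mx_eq0 => /andP[/eqP ab /eqP bc].
by split; apply/eqP; rewrite -subr_eq0 -mulmxBl -[_ *m _]trmxK trmx_mul trmxK
  ?ab ?bc trmx0.
Qed.

Lemma nonroot_small (q : {poly R}) (eps : R) : q != 0 -> 0 < eps ->
  exists2 t, 0 < t < eps & ~~ root q t.
Proof.
move=> q0 eps0.
(* [size q] distinct candidates are one more than the possible roots; the denominators start at 2 to
   stay strictly below [eps]. *)
pose s := [seq eps / i.+2%:R | i <- iota 0 (size q)].
have us : uniq s.
  rewrite map_inj_uniq ?iota_uniq // => i j /(mulfI (lt0r_neq0 eps0)).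
  by move/invr_inj/eqP; rewrite eqr_nat => /eqP [].
have /allPn[t ts tq] : ~~ all (root q) s.
  apply/negP => qs; have := max_poly_roots q0 qs us.
  by rewrite size_map size_iota ltnn.
exists t => //; move: ts => /mapP[i _ ->].
rewrite divr_gt0 //= ltr_pdivrMr // ltr_pMr // ltr1n //.
Qed.

(* A plane meets the moment curve in at most three points. *)
Definition moment (t : R) : 'rV[R]_3 := \row_j t ^+ j.+1.

(** Along the curve each plane becomes a nonzero polynomial of degree at most 3 in [t]; the product
    of finitely many has nonroots arbitrarily close to 0. *)
Lemma off_planes (I : finType) (u : I -> 'rV[R]_3) (k : I -> R) (c : 'rV[R]_3)
    (eps : R) : (forall i, u i != 0) -> 0 < eps ->
  exists2 t, 0 < t < eps &
    forall i, ((c + moment t) *m (u i)^T) ord0 ord0 != k i.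
Proof.
move=> u0 eps0.
pose q i : {poly R} := Poly [:: (c *m (u i)^T) ord0 ord0 - k i;
  u i ord0 ord0; u i ord0 1; u i ord0 2%:R].
have q0 i : q i != 0.
  apply: contra_neq (u0 i) => qi; apply/rowP => j; rewrite mxE.
  have qj l : nth 0 [:: (c *m (u i)^T) ord0 ord0 - k i;
      u i ord0 ord0; u i ord0 1; u i ord0 2%:R] l = 0.
    by rewrite -coef_Poly -[Poly _]/(q i) qi coef0.
  by case: j => [[|[|[|]]]] // lt3; [rewrite -(qj 1%N)|rewrite -(qj 2%N)
    |rewrite -(qj 3%N)] => /=; congr (u i _ _); exact: val_inj.
have pq : \prod_i q i != 0 by apply/prodf_neq0.
have [t t01 tq] := nonroot_small pq eps0.
exists t => // i; rewrite -subr_eq0.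
have -> : ((c + moment t) *m (u i)^T) ord0 ord0 - k i = (q i).[t].
  rewrite horner_Poly /= mulmxDl !mxE.
  rewrite [X in _ + X - _](_ : _ = u i ord0 ord0 * t + u i ord0 1 * t ^+ 2 +
      u i ord0 2%:R * t ^+ 3).
    by ring.
  rewrite !big_ord_recl big_ord0 !mxE /= addr0 !addrA expr1.
  by congr (_ + _ + _); rewrite mulrC //; congr (u i _ _ * _); exact: val_inj.
move: tq; apply: contra => qi; rewrite /root horner_prod.
by apply/prodf_eq0; exists i.
Qed.

(** The vertices outside [B] are placed one at a time, off a plane through every triple of points.
    With [t < eps <= 1] the powers of [t] are at most [t], which bounds the displacement of each
    coordinate. *)
Lemma generic_placement (B : pred G) (c : G -> 'rV[R]_3) (b0 : G) (eps : R) :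
  B b0 -> 0 < eps <= 1 -> cell_injective_on B c ->
  exists p, [/\ forall v, B v -> p v = c v,
    forall v j, `|p v ord0 j - c v ord0 j| < eps & cell_injective p].
Proof.
move=> Bb0 /andP[eps0 eps1] cinj.
suff H (s : seq G) : exists p, [/\ forall v, B v -> p v = c v,
    forall v j, `|p v ord0 j - c v ord0 j| < eps &
    cell_injective_on [pred v | B v || (v \in s)] p].
  have [p [p1 p2 p3]] := H (index_enum G); exists p; split=> // u v u' v' t s *.
  by apply: (p3 u v u' v' t s) => //=; rewrite mem_index_enum orbT.
elim: s => [|w s [p [pB pc pinj]]].
  exists c; split=> // [v j|u v u' v' t s]; first by rewrite subrr normr0.
  by rewrite /= !inE !orbF; exact: cinj.
have [ws|ws] := boolP (B w || (w \in s)).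
  exists p; split=> // u v u' v' t r Du Dv Du' Dv'.
  have Dsub x : [pred v | B v || (v \in w :: s)] x -> [pred v | B v || (v \in s)] x.
    by rewrite /= inE => /or3P[->|/eqP->|->]; rewrite ?orbT.
  by apply: pinj; exact: Dsub.
have /all_sig2[u u0 uE] : forall abc : G * G * G, {u : 'rV[R]_3 | u != 0 &
    (p abc.1.1 *m u^T = p abc.1.2 *m u^T) /\ (p abc.1.2 *m u^T = p abc.2 *m u^T)}.
  by move=> [[a b] d]; apply: cid2; exact: common_plane.
have [t /andP[t0 teps] tu] :=
  off_planes (fun abc => (p abc.1.1 *m (u abc)^T) ord0 ord0) (c w) u0 eps0.
pose p' v := if v == w then c w + moment t else p v.
have p'E v : v != w -> p' v = p v by rewrite /p' => /negPf ->.
have Dw v : B v || (v \in s) -> v != w.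
  by apply: contraTneq => ->.
exists p'; split.
- by move=> v Bv; rewrite p'E ?pB // Dw // Bv.
- move=> v j; rewrite /p'; case: eqP => [->|_]; last exact: pc.
  rewrite !mxE addrAC subrr add0r ger0_norm ?exprn_ge0 ?ltW //.
  have t1 : t <= 1 by exact: ltW (lt_le_trans teps eps1).
  by apply: le_lt_trans teps; rewrite exprS ger_pMr // exprn_ile1 // ltW.
have inj' : cell_injective_on [pred v | B v || (v \in s)] p'.
  move=> a b a' b' r q Da Db Da' Db'; rewrite !p'E ?Dw //.
  exact: pinj.
have add : cell_injective_on [pred v | (B v || (v \in s)) || (v == w)] p'.
  apply: (@cell_injective_add [pred v | B v || (v \in s)] _ _ b0) => //=.
    by rewrite Bb0.
  move=> a b d Da Db Dd; exists (fun x => (x *m (u (a, b, d))^T) ord0 ord0).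
  have [ab bd] := uE (a, b, d); rewrite /= in ab bd.
  rewrite (p'E a) ?Dw // (p'E b) ?Dw // (p'E d) ?Dw //; split.
  - by move=> r x y; rewrite /lerp mulmxDl -!scalemxAl !mxE.
  - by rewrite /= ab.
  - by rewrite /= bd.
  - by rewrite /p' eqxx; exact: (tu (a, b, d)).
have Dsub x : [pred v | B v || (v \in w :: s)] x ->
    [pred v | (B v || (v \in s)) || (v == w)] x.
  by rewrite /= inE => /or3P[->|->|->]; rewrite ?orbT.
move=> a b a' b' r q Da Db Da' Db'; apply: add; exact: Dsub.
Qed.

End generic_position.

(** * The trefoil in open-book position *)

Section open_book.
Variable R : realType.

(* Five half-planes ("pages") bounded by the z-axis cut space into five sectors;
   page i separates sector i - 1 (sector 4 if i = 0) from sector i.  The trefoil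
   meets page i in two edges of a triangle whose third side lies on the axis; on
   the page, the triangle is the region where [lower i] and [upper i] are
   positive.  The origin is arbitrarily put in sector 0. *)
Definition sector (a b : R) : nat :=
  if (0 <= b) && (0 < a) then 0
  else if (a <= 0) && (0 < a + b) then 1
  else if (a + b <= 0) && (a < b) then 2
  else if (b <= a) && (a < 0) then 3
  else if (0 <= a) && (b < 0) then 4 else 0.

(** Affine forms on all of space, so that their signs persist in a neighbourhood of a point of the
    page. *)
Definition lower (i : nat) (a b z : R) : R :=
  nth 0 [:: z + 20 - a; z + 10 - b; z - (b - a) / 2;
            z + 20 + 3 / 2 * a; z + 10 + 3 / 2 * b] i.

Definition upper (i : nat) (a b z : R) : R :=
  nth 0 [:: - z - a; 10 - b - z; 20 - (b - a) / 2 - z;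
            10 + 3 / 2 * a - z; 20 + 3 / 2 * b - z] i.

Definition inside (i : nat) (a b z : R) : bool :=
  (0 < lower i a b z) && (0 < upper i a b z).

Definition on_page (i : nat) (a b : R) : bool :=
  nth false [:: (b == 0) && (0 <= a); (a == 0) && (0 <= b);
    (a == - b) && (0 <= b); (a == b) && (a <= 0); (a == 0) && (b <= 0)] i.

Definition near_page (i : nat) (a b : R) : bool :=
  nth false [:: 0 < a; (0 < b) && (0 < a + b); (a < 0) && (a < b);
    (a < 0) && (a + b < 0); (b < 0) && (b < a)] i.

(** Half-open wedges: page i without the axis is counted in sector i. *)
Definition in_sector (i : nat) (a b : R) : bool :=
  nth false [:: (0 <= b) && (0 < a); (a <= 0) && (0 < a + b);
    (a + b <= 0) && (a < b); (b <= a) && (a < 0); (0 <= a) && (b < 0)] i.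

Lemma sector_in (i : nat) (a b : R) : in_sector i a b -> sector a b = i.
Proof.
rewrite /sector /in_sector; case: i => [|[|[|[|[|i]]]]] /=; last by rewrite nth_nil.
- by move=> ->.
- by move=> ab; do 1![case: ifP => [?|_]; first by exfalso; lra]; rewrite ab.
- by move=> ab; do 2![case: ifP => [?|_]; first by exfalso; lra]; rewrite ab.
- by move=> ab; do 3![case: ifP => [?|_]; first by exfalso; lra]; rewrite ab.
- by move=> ab; do 4![case: ifP => [?|_]; first by exfalso; lra]; rewrite ab.
Qed.

Lemma sector_near_page (i : nat) (a b : R) : near_page i a b ->
  sector a b = i \/ sector a b = (if i is j.+1 then j else 4).
Proof.
have wE j : in_sector j a b -> sector a b = j by exact: sector_in.
rewrite /near_page; case: i => [|[|[|[|[|i]]]]] /=; last by rewrite nth_nil.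
- move=> ab; case: (lerP 0 b) => h; [left|right]; apply: wE; rewrite /in_sector /=; lra.
- move=> ab; case: (lerP a 0) => h; [left|right]; apply: wE; rewrite /in_sector /=; lra.
- move=> ab; case: (lerP (a + b) 0) => h; [left|right]; apply: wE; rewrite /in_sector /=; lra.
- move=> ab; case: (lerP b a) => h; [left|right]; apply: wE; rewrite /in_sector /=; lra.
- move=> ab; case: (lerP 0 a) => h; [left|right]; apply: wE; rewrite /in_sector /=; lra.
Qed.

Lemma plane_cases (a b : R) :
  (a == 0) && (b == 0) \/
  (exists2 i, (i < 5)%N & on_page i a b && near_page i a b) \/
  (exists2 i, (i < 5)%N & nth false
    [:: (0 < b) && (0 < a); (a < 0) && (0 < a + b);
        (a + b < 0) && (a < b); (b < a) && (a < 0); (0 < a) && (b < 0)] i).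
Proof.
have [a0|a0|a0] := ltgtP a 0; have [b0|b0|b0] := ltgtP b 0.
- have [ab|ab|ab] := ltgtP a b.
  + by right; right; exists 2 => //; rewrite /on_page /near_page /=; lra.
  + by right; right; exists 3 => //; rewrite /on_page /near_page /=; lra.
  + by right; left; exists 3 => //; rewrite /on_page /near_page /=; lra.
- have [ab|ab|ab] := ltgtP (a + b) 0.
  + by right; right; exists 2 => //; rewrite /on_page /near_page /=; lra.
  + by right; right; exists 1 => //; rewrite /on_page /near_page /=; lra.
  + by right; left; exists 2 => //; rewrite /on_page /near_page /=; lra.
- by right; right; exists 2 => //; rewrite /on_page /near_page /=; lra.
- by right; right; exists 4 => //; rewrite /on_page /near_page /=; lra.
- by right; right; exists 0 => //; rewrite /on_page /near_page /=; lra.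
- by right; left; exists 0 => //; rewrite /on_page /near_page /=; lra.
- by right; left; exists 4 => //; rewrite /on_page /near_page /=; lra.
- by right; left; exists 1 => //; rewrite /on_page /near_page /=; lra.
- by left.
Qed.

Section book_cocycle.
Local Open Scope group_scope.
Variables (Q : groupType) (a b : Q).
Hypothesis braid : a * b * a = b * a * b.

(* The holonomy of a loop crossing page i inside its triangle and coming back
   outside.  Around the axis, at any height, the product of the holonomies of the
   triangles met is 1; solving these relations for the triangles, whose vertices
   on the axis have ranks {0,2}, {1,3}, {2,4}, {0,3}, {1,4}, leaves two generators
   and the braid relation. *)
Definition page_gen (i : nat) : Q :=
  nth 1 [:: a; b; a * b * a^-1; a^-1; a * b^-1 * a^-1] i.

Definition crossing (i : nat) (v : bool) : Q := if v then page_gen i else 1.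

(** What is collected from sector 0 to sector [j] across pages 1 to [j]; page 0 serves as the
    cut. *)
Fixpoint sheet (j : nat) (v : nat -> bool) : Q :=
  if j is k.+1 then sheet k v * crossing j (v j) else 1.

Lemma eq_sheet j v w : (forall i, (i <= j)%N -> v i = w i) ->
  sheet j v = sheet j w.
Proof.
elim: j => //= j IH vw; rewrite IH => [|i /leqW]; last exact: vw.
by rewrite vw.
Qed.

Local Notation sector_of p := (sector p.1.1 p.1.2).
Local Notation inside_of i p := (inside i p.1.1 p.1.2 p.2).

(** Sectors 4 and 0 are compared directly across page 0, all others without crossing it. Triangles
    are tested at [p] alone, so the value is meaningful only while the relevant tests stay
    constant. *)
Definition book (p q : R * R * R) : Q :=
  let v i := inside_of i p in
  if (sector_of p == 4) && (sector_of q == 0) then crossing 0 (v 0)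
  else if (sector_of p == 0) && (sector_of q == 4) then (crossing 0 (v 0))^-1
  else (sheet (sector_of p) v)^-1 * sheet (sector_of q) v.

Lemma cocycle_on_coboundary (X : topologicalType) (T : X -> X -> Q)
    (A : set X) (K : X -> Q) :
  (forall x y, A x -> A y -> T x y = (K x)^-1 * K y) -> cocycle_on T A.
Proof.
move=> TK x y z Ax Ay Az; rewrite !TK //.
by rewrite mulgA -(mulgA _ (K y)) mulgV mulg1.
Qed.

Lemma sector_le4 (p q : R) : (sector p q <= 4)%N.
Proof. by rewrite /sector; do !case: ifP => _ //. Qed.

Lemma book_sector p q : sector_of p = sector_of q -> book p q = 1.
Proof.
move=> pq; rewrite /book pq; case: eqP => [->|_] //=.
  by rewrite mulVg.
by case: eqP => [->|_] /=; rewrite mulVg.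
Qed.

Lemma book_page i c p q : (i < 5)%N ->
  near_page i p.1.1 p.1.2 -> near_page i q.1.1 q.1.2 ->
  inside_of i p = c ->
  book p q = (crossing i (c && (sector_of p == i)))^-1 *
             crossing i (c && (sector_of q == i)).
Proof.
move=> i5 /sector_near_page wp /sector_near_page wq pc.
have [pq|pq] := eqVneq (sector_of p) (sector_of q).
  by rewrite (book_sector pq) pq mulVg.
have crossF j : crossing j false = 1 by [].
rewrite /book; case: i => [|i] in i5 wp wq pc pq *.
  rewrite pc; case: wp wq pq => -> [] ->; rewrite //= ?andbT ?andbF ?crossF;
    by rewrite ?invg1 ?mul1g ?mulg1.
have {}i5 : (i < 4)%N by [].
have [iN4 SiN0] : (i == 4 = false) * (i.+1 == 0 = false) by rewrite ltn_eqF.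
case: wp wq pq => -> [] ->; rewrite ?eqxx // ?SiN0 ?iN4 ?andbF /= => _.
- rewrite pc ?eqxx (ltn_eqF (ltnSn i)) andbT andbF crossF mulg1.
  rewrite ifF; last by case: i i5 {pc iN4 SiN0} => [|[|[|[|]]]].
  by rewrite invgM -mulgA mulVg mulg1.
- rewrite ifF; last by case: i i5 {pc iN4 SiN0} => [|[|[|[|]]]].
  by rewrite pc (ltn_eqF (ltnSn i)) andbT andbF crossF invg1 mul1g mulgA mulVg mul1g.
Qed.

(** A trivial circuit around the axis means that crossing page 0 amounts to going the other way
    round, so the sheets are a potential. *)
Lemma book_axis (v : nat -> bool) p q :
  (forall i, (i < 5)%N -> inside_of i p = v i) ->
  sheet 4 v * crossing 0 (v 0) = 1 ->
  book p q = (sheet (sector_of p) v)^-1 * sheet (sector_of q) v.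
Proof.
move=> pv rel; rewrite /book pv //.
have sv j : (j <= 4)%N -> sheet j (fun i => inside_of i p) = sheet j v.
  by move=> j4; apply: eq_sheet => i ij; rewrite pv // ltnS (leq_trans ij).
rewrite !sv ?sector_le4 //.
have c0 : crossing 0 (v 0) = (sheet 4 v)^-1.
  by rewrite -[LHS](mulKg (sheet 4 v)) rel mulg1.
case: ifP => [/andP[/eqP -> /eqP ->]|_]; first by rewrite c0 [sheet 0 v]/= mulg1.
case: ifP => [/andP[/eqP -> /eqP ->]|_] //.
by rewrite c0 invgK [sheet 0 v]/= invg1 mul1g.
Qed.

(** The excluded heights are the triangle corners on the axis. Between them the circuit cancels
    freely, except for 0 < z < 10, where pages 1 to 4 give [b * a * b * a^-1 * b^-1 * a^-1], the
    braid relation. *)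
Lemma axis_relation (z : R) :
  z \notin [:: -20; -10; 0; 10; 20]%R ->
  sheet 4 (fun i => inside i 0%R 0%R z) * crossing 0 (inside 0 0%R 0%R z) = 1.
Proof.
rewrite !inE !negb_or => /and5P[z1 z2 z3 z4 z5].
have ba : b * a * b * a^-1 * b^-1 * a^-1 = 1.
  by rewrite -braid !mulgK mulgV.
pose ins (l : seq bool) := forall i, (i < 5)%N -> inside i 0%R 0%R z = nth false l i.
have relE l : ins l ->
    sheet 4 (fun i => nth false l i) * crossing 0 (nth false l 0) = 1 ->
    sheet 4 (fun i => inside i 0%R 0%R z) * crossing 0 (inside 0 0%R 0%R z) = 1.
  move=> insl <-; rewrite insl //; congr (_ * _); apply: eq_sheet => i i4.
  exact: insl.
have iE i : (i < 5)%N -> inside i 0%R 0%R z = nth false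
    [:: (-20 < z) && (z < 0); (-10 < z) && (z < 10); (0 < z) && (z < 20);
        (-20 < z) && (z < 10); (-10 < z) && (z < 20)]%R i.
  by case: i => [|[|[|[|[|]]]]] // _; rewrite /inside /lower /upper /=;
    apply/idP/idP; lra.
have decide l : all (fun i => nth false
    [:: (-20 < z) && (z < 0); (-10 < z) && (z < 10); (0 < z) && (z < 20);
        (-20 < z) && (z < 10); (-10 < z) && (z < 20)]%R i == nth false l i)
    (iota 0 5) -> ins l.
  move=> /allP h i i5; rewrite iE //; apply/eqP; apply: h.
  by rewrite mem_iota.
case: (ltgtP z (-20)%R) z1 => // {}z1 _.
  apply: (relE [:: false; false; false; false; false]).
  by apply: decide; rewrite /= andbT; repeat (apply/andP; split);
    rewrite ?eqbF_neg ?eqb_id; lra.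
  by rewrite /= /crossing /page_gen /= ?mulg1 ?mul1g.
case: (ltgtP z (-10)%R) z2 => // {}z2 _.
  apply: (relE [:: true; false; false; true; false]).
  by apply: decide; rewrite /= andbT; repeat (apply/andP; split);
    rewrite ?eqbF_neg ?eqb_id; lra.
  by rewrite /= /crossing /page_gen /= ?mulg1 ?mul1g mulVg.
case: (ltgtP z 0%R) z3 => // {}z3 _.
  apply: (relE [:: true; true; false; true; true]).
  by apply: decide; rewrite /= andbT; repeat (apply/andP; split);
    rewrite ?eqbF_neg ?eqb_id; lra.
  by rewrite /= /crossing /page_gen /= ?mulg1 ?mul1g !mulgA !mulgVK mulgV.
case: (ltgtP z 10%R) z4 => // {}z4 _.
  apply: (relE [:: false; true; true; true; true]).
  by apply: decide; rewrite /= andbT; repeat (apply/andP; split);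
    rewrite ?eqbF_neg ?eqb_id; lra.
  by rewrite /= /crossing /page_gen /= ?mulg1 ?mul1g !mulgA mulgVK.
case: (ltgtP z 20%R) z5 => // {}z5 _.
  apply: (relE [:: false; false; true; false; true]).
  by apply: decide; rewrite /= andbT; repeat (apply/andP; split);
    rewrite ?eqbF_neg ?eqb_id; lra.
  by rewrite /= /crossing /page_gen /= ?mulg1 ?mul1g !mulgA mulgVK mulgK mulgV.
apply: (relE [:: false; false; false; false; false]).
  by apply: decide; rewrite /= andbT; repeat (apply/andP; split);
    rewrite ?eqbF_neg ?eqb_id; lra.
by rewrite /= /crossing /page_gen /= ?mulg1 ?mul1g.
Qed.

End book_cocycle.
End open_book.

Section trefoil.
Variable R : realType.

(** Odd positions lie on the axis, at heights -20, 0, 20, -10, 10; even positions are the apexes of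
    the triangles of pages 3, 0, 2, 4, 1. *)
Definition knot_seq : seq (R * R * R) :=
  [:: (-10, -10, -5); (0, 0, -20); (10, 0, -10); (0, 0, 0); (-10, 10, 10);
      (0, 0, 20); (0, -10, 5); (0, 0, -10); (0, 10, 0); (0, 0, 10)].

Definition knot (i : nat) : R * R * R := nth (0, 0, 0) knot_seq (i %% 10).

Definition lerp3 (t : R) (p q : R * R * R) : R * R * R :=
  ((1 - t) * p.1.1 + t * q.1.1, (1 - t) * p.1.2 + t * q.1.2,
   (1 - t) * p.2 + t * q.2).

Definition on_knot (x : R * R * R) : Prop :=
  exists i t, [/\ (i < 10)%N, 0 <= t <= 1 & x = lerp3 t (knot i) (knot i.+1)].

Lemma on_knot_lower i (a b z : R) : (i < 5)%N -> on_page i a b ->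
  lower i a b z = 0 -> 0 <= upper i a b z -> on_knot (a, b, z).
Proof.
rewrite /on_page /lower /upper.
case: i => [|[|[|[|[|]]]]] // _ /= ab z0 z1;
  [exists 1%N, (a / 10)|exists 7%N, (b / 10)|exists 3%N, (b / 10)
  |exists 0%N, (1 + a / 10)|exists 6%N, (1 + b / 10)]; split=> //;
  first [by rewrite /lerp3 /knot /=; congr (_, _, _); lra | lra].
Qed.

Lemma on_knot_upper i (a b z : R) : (i < 5)%N -> on_page i a b ->
  upper i a b z = 0 -> 0 <= lower i a b z -> on_knot (a, b, z).
Proof.
rewrite /on_page /lower /upper.
case: i => [|[|[|[|[|]]]]] // _ /= ab z0 z1;
  [exists 2%N, (1 - a / 10)|exists 8%N, (1 - b / 10)|exists 4%N, (1 - b / 10)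
  |exists 9%N, (- a / 10)|exists 5%N, (- b / 10)]; split=> //;
  first [by rewrite /lerp3 /knot /=; congr (_, _, _); lra | lra].
Qed.

Section complement_cocycle.
Variables (X : topologicalType) (cx cy cz : X -> R).
Hypotheses (ccx : continuous cx) (ccy : continuous cy) (ccz : continuous cz).
Variables (Q : groupType) (g h : Q).
Hypothesis braid : (g * h * g = h * g * h)%g.
Let pos (x : X) : R * R * R := (cx x, cy x, cz x).
Hypothesis off_knot : forall x, ~ on_knot (pos x).

Definition book_on (x y : X) : Q := book g h (pos x) (pos y).

Lemma near_gt0 (f : X -> R) (x : X) : continuous f -> 0 < f x ->
  \forall y \near x, 0 < f y.
Proof.
move=> cf fx; have := cf x; move/cvgr_gt => /(_ _ fx); exact.
Qed.

Lemma near_lt0 (f : X -> R) (x : X) : continuous f -> f x < 0 ->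
  \forall y \near x, f y < 0.
Proof.
move=> cf fx; have := cf x; move/cvgr_lt => /(_ _ fx); exact.
Qed.

Lemma linear_continuous3 (k k1 k2 k3 : R) :
  continuous (fun x => k + k1 * cx x + k2 * cy x + k3 * cz x).
Proof.
have cst (c : R) : continuous (fun _ : X => c) by move=> x; exact: cvg_cst.
have mul (c : R) (f : X -> R) (cf : continuous f) : continuous (fun x : X => c * f x).
  exact: (Defs.cmul (cst c) cf).
exact: (Defs.cadd (Defs.cadd (Defs.cadd (cst k) (mul k1 _ ccx)) (mul k2 _ ccy))
  (mul k3 _ ccz)).
Qed.

Lemma eq_linear_continuous (f : X -> R) (k k1 k2 k3 : R) :
  (forall x, f x = k + k1 * cx x + k2 * cy x + k3 * cz x) -> continuous f.
Proof. by move=> /funext ->; exact: linear_continuous3. Qed.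

Lemma lower_continuous i :
  continuous (fun x => lower i (cx x) (cy x) (cz x)).
Proof.
rewrite /lower; case: i => [|[|[|[|[|i]]]]] /=.
- by apply: (@eq_linear_continuous _ 20 (-1) 0 1) => x; lra.
- by apply: (@eq_linear_continuous _ 10 0 (-1) 1) => x; lra.
- by apply: (@eq_linear_continuous _ 0 2^-1 (- 2^-1) 1) => x; lra.
- by apply: (@eq_linear_continuous _ 20 (3 / 2) 0 1) => x; lra.
- by apply: (@eq_linear_continuous _ 10 0 (3 / 2) 1) => x; lra.
- by apply: (@eq_linear_continuous _ 0 0 0 0) => x; rewrite nth_nil; lra.
Qed.

Lemma upper_continuous i :
  continuous (fun x => upper i (cx x) (cy x) (cz x)).
Proof.
rewrite /upper; case: i => [|[|[|[|[|i]]]]] /=.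
- by apply: (@eq_linear_continuous _ 0 (-1) 0 (-1)) => x; lra.
- by apply: (@eq_linear_continuous _ 10 0 (-1) (-1)) => x; lra.
- by apply: (@eq_linear_continuous _ 20 2^-1 (- 2^-1) (-1)) => x; lra.
- by apply: (@eq_linear_continuous _ 10 (3 / 2) 0 (-1)) => x; lra.
- by apply: (@eq_linear_continuous _ 20 0 (3 / 2) (-1)) => x; lra.
- by apply: (@eq_linear_continuous _ 0 0 0 0) => x; rewrite nth_nil; lra.
Qed.

Lemma cxDcy_continuous : continuous (fun x => cx x + cy x).
Proof. by apply: (@eq_linear_continuous _ 0 1 1 0) => x; lra. Qed.

Lemma cxBcy_continuous : continuous (fun x => cx x - cy x).
Proof. by apply: (@eq_linear_continuous _ 0 1 (-1) 0) => x; lra. Qed.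

(** The test can jump only where one form vanishes and the other is nonnegative; on the page, such
    points lie on the knot. *)
Lemma near_inside i (x : X) : (i < 5)%N -> on_page i (cx x) (cy x) ->
  \forall y \near x,
    inside i (cx y) (cy y) (cz y) = inside i (cx x) (cy x) (cz x).
Proof.
move=> i5 xi; rewrite /inside.
have cl := @lower_continuous i; have cu := @upper_continuous i.
have [l0|l0|l0] := ltgtP (lower i (cx x) (cy x) (cz x)) 0.
- by apply: filterS (near_lt0 cl l0) => y /lt_gtF ->.
- have [u0|u0|u0] := ltgtP (upper i (cx x) (cy x) (cz x)) 0.
  + by apply: filterS (near_lt0 cu u0) => y /lt_gtF ->; rewrite andbF.
  + by apply: filterS2 (near_gt0 cl l0) (near_gt0 cu u0) => y -> ->.
  + by case: (off_knot (on_knot_upper i5 xi u0 (ltW l0))).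
- have [u0|u0] := ltP (upper i (cx x) (cy x) (cz x)) 0.
    apply: filterS (near_lt0 cu u0) => y /lt_gtF ->.
    by rewrite !andbF (lt_gtF u0) ?andbF.
  by case: (off_knot (on_knot_lower i5 xi l0 u0)).
Qed.

(** In each position of the point (axis, page, open sector) the transition elements are a coboundary
    nearby: of the sheets, of a single crossing, or of a constant. *)
Lemma book_local (x : X) : exists2 U : set X, nbhs x U & cocycle_on book_on U.
Proof.
have [/andP[/eqP a0 /eqP b0]|[[i i5 /andP[xi ni]]|[i i5 xi]]] :=
  plane_cases (cx x) (cy x).
- pose v i := inside i (cx x) (cy x) (cz x).
  have rel : (sheet g h 4 v * crossing g h 0 (v 0%N) = 1)%g.
    rewrite /v a0 b0; apply: axis_relation => //; apply/negP => z0.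
    apply: (off_knot (x := x)); rewrite /pos a0 b0.
    (* The five heights excluded by [axis_relation] are vertices of the knot. *)
    have vx (i : nat) z : (i < 10)%N -> knot i = (0, 0, z) -> on_knot (0, 0, z).
      move=> i10 ki; exists i, 0; split=> //; first by rewrite lexx ler01.
      by rewrite ki /lerp3 /= !mul0r !mulr0 !addr0 subr0 mul1r.
    move: z0; rewrite !inE => /or4P[/eqP->|/eqP->|/eqP->|/orP[]/eqP->];
      [exact: (vx 1)|exact: (vx 7)|exact: (vx 3)|exact: (vx 9)|exact: (vx 5)].
  exists [set y | forall i, (i < 5)%N -> inside i (cx y) (cy y) (cz y) = v i].
    have vi i : (i < 5)%N -> \forall y \near x, inside i (cx y) (cy y) (cz y) = v i.
      move=> i5; apply: near_inside => //; rewrite /on_page a0 b0 oppr0 eqxx lexx.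
      by case: i i5 => [|[|[|[|[|]]]]].
    near=> y => -[|[|[|[|[|]]]]] // _; near: y; exact: vi.
  apply: (@cocycle_on_coboundary Q X book_on _
    (fun y => sheet g h (sector (cx y) (cy y)) v)).
  by move=> p q pv _; exact: book_axis.
- pose c := inside i (cx x) (cy x) (cz x).
  exists [set y | near_page i (cx y) (cy y) /\ inside i (cx y) (cy y) (cz y) = c].
    near=> y; split; near: y; last exact: near_inside.
    move: ni; rewrite /near_page; case: i i5 {c xi} => [|[|[|[|[|]]]]] // _ /=.
    + exact: near_gt0.
    + case/andP=> ? ?; near=> y; apply/andP; split; near: y.
        exact: near_gt0.
      exact: near_gt0 cxDcy_continuous _.
    + case/andP=> ? ab; near=> y; apply/andP; split.
        by near: y; exact: near_lt0.
      rewrite -subr_lt0; near: y; apply: near_lt0 cxBcy_continuous _.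
      by rewrite subr_lt0.
    + case/andP=> ? ?; near=> y; apply/andP; split; near: y.
        exact: near_lt0.
      exact: near_lt0 cxDcy_continuous _.
    + case/andP=> ? ba; near=> y; apply/andP; split.
        by near: y; exact: near_lt0.
      rewrite -subr_gt0; near: y; apply: near_gt0 cxBcy_continuous _.
      by rewrite subr_gt0.
  apply: (@cocycle_on_coboundary Q X book_on _
    (fun y => crossing g h i (c && (sector (cx y) (cy y) == i)))).
  by move=> p q [np pc] [nq _]; exact: book_page.
- exists [set y | sector (cx y) (cy y) = i]; last first.
    apply: (@cocycle_on_coboundary Q X book_on _ (fun=> 1%g)).
    by move=> p q pi qi; rewrite /book_on book_sector ?pi ?qi // invg1 mulg1.
  suff : \forall y \near x, in_sector i (cx y) (cy y).
    by apply: filterS => y; exact: sector_in.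
  rewrite /in_sector; case: i i5 xi => [|[|[|[|[|]]]]] // _ /= /andP[p1 p2].
  + by near=> y; apply/andP; split; [apply: ltW|]; near: y; exact: near_gt0.
  + near=> y; apply/andP; split; [apply: ltW|]; near: y.
      exact: near_lt0.
    exact: near_gt0 cxDcy_continuous _.
  + near=> y; apply/andP; split; [apply: ltW|rewrite -subr_lt0]; near: y.
      exact: near_lt0 cxDcy_continuous _.
    by apply: near_lt0 cxBcy_continuous _; rewrite subr_lt0.
  + near=> y; apply/andP; split; [rewrite -subr_ge0; apply: ltW|]; near: y.
      by apply: near_gt0 cxBcy_continuous _; rewrite subr_gt0.
    exact: near_lt0.
  + near=> y; apply/andP; split; [apply: ltW|]; near: y.
      exact: near_gt0.
    exact: near_lt0.
Unshelve. all: by end_near.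
Qed.

End complement_cocycle.
End trefoil.

(** * The trefoil group in the wreath product of Z^2 with S_3 *)

Section trefoil_representation.
Local Open Scope group_scope.

(* The weights come from the action of the braid group on three strands: at colour
   i, the first one records the turns of strand i around the two others, and the
   second one the half-turns of those two around each other. *)
Definition gen_a : wreath mulint2 3 :=
  ([ffun i : 'I_3 => nth (0, 0) [:: (0, 0); (1, 0); (0, 1)] i : mulint2]%R,
   tperm ord0 1%R).

Definition gen_b : wreath mulint2 3 :=
  ([ffun i : 'I_3 => nth (0, 0) [:: (0, 1); (0, 0); (1, 0)] i : mulint2]%R,
   tperm 1%R 2%:R%R).

Lemma ord3_cases (i : 'I_3) : [\/ i = ord0, i = 1%R | i = 2%:R%R].
Proof.
by case: i => [[|[|[|]]]] // lt3; [apply: Or31|apply: Or32|apply: Or33];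
  apply: val_inj.
Qed.

Lemma gen_a1 i : gen_a.1 i = nth (0, 0)%R [:: (0, 0); (1, 0); (0, 1)]%R i.
Proof. by rewrite ffunE. Qed.

Lemma gen_b1 i : gen_b.1 i = nth (0, 0)%R [:: (0, 1); (0, 0); (1, 0)]%R i.
Proof. by rewrite ffunE. Qed.

Lemma gen_a2 : [/\ gen_a.2 ord0 = 1%R, gen_a.2 1%R = ord0 &
  gen_a.2 2%:R%R = 2%:R%R].
Proof. by rewrite /gen_a /= tpermL tpermR tpermD. Qed.

Lemma gen_b2 : [/\ gen_b.2 ord0 = ord0, gen_b.2 1%R = 2%:R%R &
  gen_b.2 2%:R%R = 1%R].
Proof. by rewrite /gen_b /= tpermL tpermR tpermD. Qed.

Lemma gen_braid : gen_a * gen_b * gen_a = gen_b * gen_a * gen_b.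
Proof.
have [a0 a1 a2] := gen_a2; have [b0 b1 b2] := gen_b2.
apply: wreath_ext => i.
  by rewrite !wreath_mul1E !wreath_mul2E;
  case: (ord3_cases i) => ->; rewrite ?(a0, a1, a2, b0, b1, b2) !gen_a1 !gen_b1.
by rewrite !wreath_mul2E; case: (ord3_cases i) => ->;
  rewrite ?(a0, a1, a2, b0, b1, b2).
Qed.

Lemma meridian_weight :
  (gen_a^-1).2 2%:R%R = 2%:R%R /\ (gen_a^-1).1 2%:R%R = (0, -1)%R.
Proof.
have [_ _ a2] := gen_a2; split; first exact: wreath_inv2E.
by rewrite (wreath_inv1E a2) gen_a1.
Qed.

(** Colour 2 is the one fixed by the transposition of [gen_a]. The determinant of the meridian
    weight (0, -1) and this weight (2, -1) is 2, hence nonzero. *)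
Lemma longitude_weight :
  let l := gen_b * gen_a * (gen_a * gen_b * gen_a^-1) in
  l.2 2%:R%R = 2%:R%R /\ l.1 2%:R%R = (2, -1)%R.
Proof.
have [a0 a1 a2] := gen_a2; have [b0 b1 b2] := gen_b2.
have [i2 w2] := meridian_weight.
move=> l; rewrite /l {l}; split.
  by rewrite !wreath_mul2E ?(a0, a1, a2, b0, b1, b2, i2).
rewrite !wreath_mul1E !wreath_mul2E ?(a0, a1, a2, b0, b1, b2, i2, w2).
by rewrite !gen_a1 !gen_b1.
Qed.

End trefoil_representation.

(** * Evaluating the cocycle along a segment *)

Section evaluation.
Variables (R : realType) (X : topologicalType) (cx cy cz : X -> R).
Hypotheses (ccx : continuous cx) (ccy : continuous cy) (ccz : continuous cz).
Variables (Q : groupType) (g h : Q).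
Local Notation T := (book_on cx cy cz g h).
Local Notation carries := (carries T).
Local Notation I := (unitI R).

Let pos (x : X) : R * R * R := (cx x, cy x, cz x).

Lemma cocycle_on_sector i :
  cocycle_on T [set x | in_sector i (cx x) (cy x)].
Proof.
apply: (@cocycle_on_coboundary Q X T _ (fun=> 1%g)) => x y xi yi.
rewrite /book_on book_sector ?invg1 ?mulg1 //=.
by rewrite (sector_in xi) (sector_in yi).
Qed.

Lemma book_on_sector i x y :
  in_sector i (cx x) (cy x) -> in_sector i (cx y) (cy y) -> T x y = 1%g.
Proof.
by move=> /sector_in xi /sector_in yi; rewrite /book_on book_sector //= xi yi.
Qed.

Lemma cocycle_on_page i c : (i < 5)%N -> cocycle_on T
  [set x | near_page i (cx x) (cy x) && (inside i (cx x) (cy x) (cz x) == c)].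
Proof.
move=> i5; apply: (@cocycle_on_coboundary Q X T _
  (fun y => crossing g h i (c && (sector (cx y) (cy y) == i)))).
by move=> p q /andP[np /eqP pc] /andP[nq _]; exact: book_page.
Qed.

Lemma book_on_page i c x y : (i < 5)%N ->
  near_page i (cx x) (cy x) -> near_page i (cx y) (cy y) ->
  inside i (cx x) (cy x) (cz x) = c ->
  T x y = ((crossing g h i (c && (sector (cx x) (cy x) == i)))^-1 *
           crossing g h i (c && (sector (cx y) (cy y) == i)))%g.
Proof. exact: (@book_page R Q g h i c (pos x) (pos y)). Qed.

Definition runs (x y : R * R * R) (P : R -> R -> R -> bool) (lo hi : R) : Prop :=
  forall r, lo <= r <= hi ->
    P (lerp3 r x y).1.1 (lerp3 r x y).1.2 (lerp3 r x y).2.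

Section along_path.
Variables (x y : X) (p : {path I from x to y in X}).
Hypothesis pE : forall r : R, 0 <= r <= 1 ->
  pos (p (clamp r)) = lerp3 r (pos x) (pos y).

Let posE (r : R) : 0 <= r <= 1 ->
  [/\ cx (p (clamp r)) = (lerp3 r (pos x) (pos y)).1.1,
      cy (p (clamp r)) = (lerp3 r (pos x) (pos y)).1.2 &
      cz (p (clamp r)) = (lerp3 r (pos x) (pos y)).2].
Proof. by move=> /pE <-. Qed.

Lemma carries_in_sector i :
  runs (pos x) (pos y) (fun a b _ => in_sector i a b) 0 1 -> carries p 1%g.
Proof.
move=> run.
have mem t : in_sector i (cx (p t)) (cy (p t)).
  rewrite -(unitIK t); have t01 := unitI_bounds t.
  by have [-> -> _] := posE t01; exact: run.
have p0 : p zero = x by exact: path_zero.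
have p1 : p one = y by exact: path_one.
have <- : T x y = 1%g.
  by apply: (@book_on_sector i); [rewrite -p0|rewrite -p1]; exact: mem.
exact: (carries_cocycle (@cocycle_on_sector i)).
Qed.

Lemma carries_outside i : (i < 5)%N ->
  runs (pos x) (pos y) (fun a b z => near_page i a b && ~~ inside i a b z) 0 1 ->
  carries p 1%g.
Proof.
move=> i5 run.
have mem t : near_page i (cx (p t)) (cy (p t)) &&
    (inside i (cx (p t)) (cy (p t)) (cz (p t)) == false).
  rewrite -(unitIK t) eqbF_neg; have t01 := unitI_bounds t.
  by have [-> -> ->] := posE t01; exact: run.
have p0 : p zero = x by exact: path_zero.
have p1 : p one = y by exact: path_one.
have <- : T x y = 1%g.
  have := mem zero; have := mem one; rewrite p0 p1 => /andP[yn _] /andP[xn /eqP xi].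
  by rewrite (book_on_page i5 xn yn xi) /crossing invg1 mulg1.
exact: (carries_cocycle (@cocycle_on_page i false i5)).
Qed.

(** A segment may satisfy the triangle's inequalities only in its later part, so its first half is
    controlled by its sector alone. The formula covers both directions of crossing. *)
Lemma carries_through i j : (i < 5)%N ->
  runs (pos x) (pos y) (fun a b _ => in_sector j a b) 0 2^-1 ->
  runs (pos x) (pos y) (fun a b z => near_page i a b && inside i a b z) 2^-1 1 ->
  carries p ((crossing g h i (j == i))^-1 *
             crossing g h i (sector (cx y) (cy y) == i))%g.
Proof.
move=> i5 run1 run2.
have mem1 (r : R) : 0 <= r <= 2^-1 -> in_sector j (cx (p (clamp r))) (cy (p (clamp r))).
  move=> r01; have r01' : 0 <= r <= 1 by lra.
  by have [-> -> _] := posE r01'; exact: run1.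
have mem2 (r : R) : 2^-1 <= r <= 1 ->
    near_page i (cx (p (clamp r))) (cy (p (clamp r))) &&
    (inside i (cx (p (clamp r))) (cy (p (clamp r))) (cz (p (clamp r))) == true).
  move=> r01; have r01' : 0 <= r <= 1 by lra.
  by rewrite eqb_id; have [-> -> ->] := posE r01'; exact: run2.
have p0 : p (clamp 0) = x by exact: path_zero.
have p1 : p (clamp 1) = y by exact: path_one.
have := carries_cocycle2 (@cocycle_on_sector j) (@cocycle_on_page i true i5) mem1 mem2.
have h1 : in_sector j (cx (p (clamp 2^-1))) (cy (p (clamp 2^-1))) by apply: mem1; lra.
rewrite (@book_on_sector j) //; last by rewrite -p0; apply: mem1; lra.
have /andP[m2 /eqP m2i] := mem2 2^-1 ltac:(lra).
have /andP[yn _] := mem2 1 ltac:(lra).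
rewrite p1 in yn.
by rewrite mul1g (book_on_page i5 m2 yn m2i) /= (sector_in h1).
Qed.

End along_path.
End evaluation.

(** * The fat trefoil *)

Section fat_cycle.
Variable N : nat.

Definition fat_adj : rel ('I_10 * 'I_N) :=
  [rel u v | (v.1 == ordS u.1) || (u.1 == ordS v.1)].

Lemma fat_adj_sym : symmetric fat_adj.
Proof. by move=> u v; rewrite /fat_adj /= orbC. Qed.

Lemma ordS10_neq (i : 'I_10) : (i == ordS i) = false.
Proof. by case: i => [[|[|[|[|[|[|[|[|[|[|]]]]]]]]]]]. Qed.

Lemma fat_adj_irr : irreflexive fat_adj.
Proof. by move=> u; rewrite /fat_adj /= ordS10_neq. Qed.

Definition fat_cycle : sgraph := SGraph fat_adj_sym fat_adj_irr.

Lemma card_fat_cycle : #|fat_cycle| = (10 * N)%N.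
Proof. by rewrite card_prod !card_ord. Qed.

(** Fewer than [n <= N] deletions leave a representative in every cluster. Each survivor is adjacent
    to the representative of the next cluster, and the representatives form a cycle. *)
Lemma fat_cycle_connected n : (0 < n <= N)%N -> n_connected fat_cycle n.
Proof.
move=> /andP[n0 nN]; split.
  by rewrite card_fat_cycle (leq_ltn_trans nN) // ltn_Pmull // (leq_trans n0).
move=> S Sn.
have /choice[r rS] (a : 'I_10) : exists j : 'I_N, ((a, j) : fat_cycle) \notin S.
  apply: contrapT => /forallNP h.
  have : (N <= #|S|)%N.
    have inj : injective (fun j : 'I_N => (a, j) : fat_cycle) by move=> j k [].
    rewrite -[N in (N <= _)%N]card_ord -(card_imset _ inj).
    apply/subset_leq_card/fintype.subsetP => _ /imsetP[j _ ->].
    by have /negP := h j; rewrite negbK.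
  by rewrite leqNgt (leq_trans Sn).
have sym : connect_sym (adj_off S).
  apply: sym_connect_sym => u v; rewrite /adj_off /= [fat_adj u v]fat_adj_sym.
  by rewrite [(u \notin S) && _]andbC.
have step (u : fat_cycle) :
    u \notin S -> connect (adj_off S) u (ordS u.1, r (ordS u.1)).
  by move=> uS; apply: connect1; rewrite /adj_off /= /fat_adj /= eqxx uS rS.
have toroot (a : 'I_10) : connect (adj_off S) (a, r a) (ord0, r ord0).
  case: a => a; elim: a => [|a IH] a10.
    by rewrite (_ : Ordinal a10 = ord0) //; exact: val_inj.
  have a10' := ltnW a10.
  apply: connect_trans (IH a10'); rewrite sym.
  have := step _ (rS (Ordinal a10')); rewrite /=.
  rewrite (_ : ordS (Ordinal a10') = Ordinal a10) //.
  by apply: val_inj; rewrite /= modn_small.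
have root u : u \notin S -> connect (adj_off S) u (ord0, r ord0).
  by move=> uS; apply: connect_trans (step _ uS) (toroot _).
by move=> u v uS vS; apply: connect_trans (root _ uS) _; rewrite sym root.
Qed.

End fat_cycle.

Lemma fat_cycle_iso M N : sgraph_iso (fat_cycle M) (fat_cycle N) -> M = N.
Proof.
move=> [f /bij_eq_card + _]; rewrite !card_fat_cycle => /eqP.
by rewrite eqn_pmul2l // => /eqP.
Qed.

Section knot_embedded.
Variable R : realType.

(** For each of the 100 pairs of edges the equation is a linear system in [t] and [s]; only equal or
    consecutive edges admit solutions. *)
Lemma knot_embedded (i j : nat) (t s : R) : (i < 10)%N -> (j < 10)%N ->
  0 <= t <= 1 -> 0 <= s <= 1 ->
  lerp3 t (knot R i) (knot R i.+1) = lerp3 s (knot R j) (knot R j.+1) ->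
  [\/ i = j /\ t = s, j = (i.+1 %% 10)%N /\ t = 1 /\ s = 0 |
      i = (j.+1 %% 10)%N /\ s = 1 /\ t = 0].
Proof.
move=> i10 j10 t01 s01 [].
case: i i10 => [|[|[|[|[|[|[|[|[|[|i]]]]]]]]]] // _;
  case: j j10 => [|[|[|[|[|[|[|[|[|[|j]]]]]]]]]] // _; rewrite /knot /= => e1 e2 e3;
  first [ by exfalso; lra
        | by apply: Or31; split; [done|lra]
        | by apply: Or32; split; [done|split; lra]
        | by apply: Or33; split; [done|split; lra] ].
Qed.

End knot_embedded.

(** * Separating convex hulls by integral linear forms *)

Section separation.
Variable R : realType.

Definition coords (v : 'rV[R]_3) : R * R * R :=
  (v ord0 ord0, v ord0 1, v ord0 2%:R).

Definition vec (x : R * R * R) : 'rV[R]_3 :=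
  \row_k nth 0 [:: x.1.1; x.1.2; x.2] k.

Lemma coords_vec x : coords (vec x) = x.
Proof. by case: x => [[a b] c]; rewrite /coords !mxE. Qed.

Lemma coords_inj : injective coords.
Proof.
move=> u v [e0 e1 e2]; apply/rowP => k.
by case: (ord3_cases k) => ->.
Qed.

Lemma coords_lerp t u v : coords (lerp t u v) = lerp3 t (coords u) (coords v).
Proof. by rewrite /coords /lerp !mxE. Qed.

Definition intpt (z : int * int * int) : R * R * R :=
  (z.1.1%:~R, z.1.2%:~R, z.2%:~R).

Definition int_dot (n z : int * int * int) : int :=
  n.1.1 * z.1.1 + n.1.2 * z.1.2 + n.2 * z.2.

Definition small (n : int * int * int) : bool :=
  [&& `|n.1.1| <= 3, `|n.1.2| <= 3 & `|n.2| <= 3].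

(* An integral gap is at least 1, while moving the points of E by less than 1/10
   in each coordinate changes [int_dot n] by less than 9/10 when n is small. *)
Definition separates (n : int * int * int) (P E : seq (int * int * int)) : bool :=
  small n && all (fun p => all (fun q => int_dot n q < int_dot n p) E) P.

Let form (n : int * int * int) (v : 'rV[R]_3) : R :=
  n.1.1%:~R * v ord0 ord0 + n.1.2%:~R * v ord0 1 + n.2%:~R * v ord0 2%:R.

Let form_intpt n z : form n (vec (intpt z)) = (int_dot n z)%:~R.
Proof. by rewrite /form !mxE /= /int_dot !rmorphD !rmorphM. Qed.

Let form_lerp n t u v : form n (lerp t u v) = (1 - t) * form n u + t * form n v.
Proof. by rewrite /form /lerp !mxE; ring. Qed.

Let form_hull n (P : seq 'rV[R]_3) (k : R) v :
  (forall u, u \in P -> k <= form n u) -> hull P v -> k <= form n v.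
Proof.
move=> Pk [w [w0 w1 ->]].
have -> : form n (\sum_i w i *: P`_i) = \sum_i w i * form n P`_i.
  rewrite /form !summxE !mulr_sumr -!big_split /=; apply: eq_bigr => i _.
  by rewrite !mxE; ring.
rewrite -[k]mul1r -w1 mulr_suml; apply: ler_sum => i _.
by rewrite ler_wpM2l // Pk // mem_nth.
Qed.

Let form_near n z (u : 'rV[R]_3) : small n ->
  (forall k, `|u ord0 k - vec (intpt z) ord0 k| < 10^-1) ->
  form n u < (int_dot n z)%:~R + 1.
Proof.
move=> /and3P[n1 n2 n3] uz.
have bound (m : int) (d : R) : `|m| <= 3 -> `|d| < 10^-1 -> m%:~R * d <= 3 / 10.
  move=> m3 d1; apply: le_trans (ler_norm _) _; rewrite normrM.
  apply: ler_pM => //; last exact: ltW.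
  by rewrite -intr_norm; rewrite -(ler_int R) in m3.
have := bound _ _ n1 (uz ord0); have := bound _ _ n2 (uz 1).
have := bound _ _ n3 (uz 2%:R).
by rewrite -form_intpt /form; lra.
Qed.

Let conv_le (t x y z : R) : 0 <= t <= 1 -> x <= z -> y <= z ->
  (1 - t) * x + t * y <= z.
Proof.
move=> /andP[t0 t1] xz yz; rewrite -subr_ge0.
have -> : z - ((1 - t) * x + t * y) = (1 - t) * (z - x) + t * (z - y) by ring.
by rewrite addr_ge0 // mulr_ge0 // subr_ge0.
Qed.

Let conv_lt (t x y x' y' : R) : 0 <= t <= 1 -> x < x' -> y < y' ->
  (1 - t) * x + t * y < (1 - t) * x' + t * y'.
Proof.
move=> /andP[t0 t1] xx yy; have [->|tn0] := eqVneq t 0.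
  by rewrite subr0 !mul1r !mul0r !addr0.
apply: ler_ltD; first by rewrite ler_wpM2l ?subr_ge0 // ltW.
by rewrite ltr_pM2l // lt_def tn0.
Qed.

(** To be used with [P] the corners of a quadrilateral of the torus, [E] the ends of a knot edge,
    and [u], [v] two graph vertices near these ends. *)
Lemma separated_hull n (P E : seq (int * int * int)) p q (u v w : 'rV[R]_3) t :
  separates n P E -> p \in E -> q \in E -> 0 <= t <= 1 ->
  (forall k, `|u ord0 k - vec (intpt p) ord0 k| < 10^-1) ->
  (forall k, `|v ord0 k - vec (intpt q) ord0 k| < 10^-1) ->
  hull [seq vec (intpt x) | x <- P] w -> w <> lerp t u v.
Proof.
move=> /andP[sn PE] pE qE t01 up vq hw wE.
have : (1 - t) * ((int_dot n p)%:~R + 1) + t * ((int_dot n q)%:~R + 1) <= form n w.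
  apply: form_hull hw => _ /mapP[x xP ->]; rewrite form_intpt.
  have /allP xE := allP PE x xP.
  by apply: conv_le => //; rewrite -[X in _ + X]/(1%:~R) -intrD ler_int lezD1;
    exact: xE.
rewrite wE form_lerp leNgt conv_lt //; exact: form_near.
Qed.

End separation.

(* The integral copy of [knot_seq], on which separation is decided by computation. *)
Definition knot_int : seq (int * int * int) :=
  [:: (-10, -10, -5); (0, 0, -20); (10, 0, -10); (0, 0, 0); (-10, 10, 10);
      (0, 0, 20); (0, -10, 5); (0, 0, -10); (0, 10, 0); (0, 0, 10)].

(* Row i is a triangle around the vertex i of the knot; found by computer search,
   as are the normals below. *)
Definition torus : seq (seq (int * int * int)) :=
  [:: [:: (-13, -9, -5); (-6, -7, -5); (-10, -14, -5)];
      [:: (-2, 4, -23); (1, -1, -14); (1, -3, -23)];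
      [:: (8, 3, -10); (7, -3, -10); (15, -1, -10)];
      [:: (-2, 3, -3); (-1, -4, 0); (3, 1, 2)];
      [:: (-16, 13, 10); (-7, 4, 10); (-7, 13, 10)];
      [:: (-3, -2, 21); (0, 1, 14); (4, 1, 24)];
      [:: (-4, -12, 5); (1, -5, 5); (3, -13, 5)];
      [:: (-4, 0, -12); (1, 1, -4); (3, 0, -14)];
      [:: (-4, 8, 0); (3, 6, 0); (1, 16, 0)];
      [:: (-3, 1, 9); (1, 0, 6); (2, -1, 14)]].

Definition normals : seq (int * int * int) :=
  [:: (3, 1, -2); (-2, -3, -2); (0, -3, 2); (0, 3, -2); (1, 2, 1); (1, 0, 0);
      (1, -1, 0); (-2, -1, -2); (-3, 3, -2); (-2, -1, 2); (2, -3, 2);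
      (-2, -3, 3); (-1, -1, -1); (3, -1, -1); (3, 1, 2); (3, 2, 1); (1, 3, -2);
      (-3, 2, 3); (-2, -1, -1); (-2, -3, -1); (-1, 1, -1); (-3, -2, -1);
      (0, -1, 0); (2, -1, 3); (-3, 2, 1); (2, 2, -1); (3, 1, -1); (-1, 2, 3);
      (-2, 3, 3); (1, 1, -1); (0, 3, 2)].

Definition knot_int_vertex (i : nat) : int * int * int :=
  nth (0, 0, 0) knot_int (i %% 10).

Definition torus_pt (i c : nat) : int * int * int :=
  nth (0, 0, 0) (nth [::] torus (i %% 10)) (c %% 3).

Definition torus_quad (i c : nat) : seq (int * int * int) :=
  [:: torus_pt i c; torus_pt i c.+1; torus_pt i.+1 c; torus_pt i.+1 c.+1].

(** After reduction of [i] and [j] modulo 10 and of [c] modulo 3, there are 300 decidable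
    instances. *)
Lemma torus_separated (i c j : nat) : exists n,
  separates n (torus_quad i c) [:: knot_int_vertex j; knot_int_vertex j.+1].
Proof.
have check : all (fun i => all (fun c => all (fun j => has (fun n =>
    separates n (torus_quad i c) [:: knot_int_vertex j; knot_int_vertex j.+1])
  normals) (iota 0 10)) (iota 0 3)) (iota 0 10) by vm_compute.
have modS a b : (a %% b).+1 = a.+1 %[mod b] by rewrite -addn1 modnDml addn1.
have mem a b : (0 < b)%N -> (a %% b)%N \in iota 0 b.
  by move=> b0; rewrite mem_iota /= add0n ltn_mod.
have /allP/(_ _ (mem c 3 isT))/allP/(_ _ (mem j 10 isT))/hasP[n _ sep] :=
  allP check _ (mem i 10 isT).
exists n; move: sep; rewrite /torus_quad /torus_pt /knot_int_vertex.
by rewrite !modS !modn_mod.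
Qed.

Lemma knot_intE (R : realType) i : knot R i = intpt R (knot_int_vertex i).
Proof.
rewrite /knot /knot_int_vertex; have : (i %% 10 < 10)%N by rewrite ltn_mod.
case: (i %% 10)%N => [|[|[|[|[|[|[|[|[|[|k]]]]]]]]]] // _;
  rewrite /intpt /=; congr (_, _, _); lra.
Qed.

Section fat_trefoil.
Variables (R : realType) (N : nat).
Hypothesis N_gt0 : (0 < N)%N.
Local Notation G := (fat_cycle N).
Local Notation I := (unitI R).

Local Notation e := (@vertex_pt R G).

Let core (i : 'I_10) : G := (i, Ordinal N_gt0).

Let on_core : pred G := [pred v | v.2 == Ordinal N_gt0].

Let center (v : G) : 'rV[R]_3 := vec (knot R v.1).

Lemma knotS (i : 'I_10) : knot R (ordS i) = knot R i.+1.
Proof. by rewrite /knot /= modn_mod. Qed.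

(** Orients every core cell along the knot, a vertex being the start of its outgoing edge; as [f] is
    arbitrary, the description holds in space and in the realization at once. *)
Lemma core_cell (u v : G) (t : R) : on_core u -> on_core v -> cell u v ->
  0 <= t <= 1 -> exists (i : 'I_10) (s : R), 0 <= s <= 1 /\
    forall (V : normedModType R) (f : G -> V),
      lerp t (f u) (f v) = lerp s (f (core i)) (f (core (ordS i))).
Proof.
case: u v => [u1 u2] [v1 v2] /eqP/= -> /eqP/= -> uv t01.
have [e|[e|e]] : u1 = v1 \/ v1 = ordS u1 \/ u1 = ordS v1.
  case/orP: uv => [/eqP[->]|/orP[]/eqP]; first by left.
    by right; left.
  by right; right.
- exists u1, 0; split; first by rewrite lexx ler01.
  by move=> V f; rewrite lerp0 -e lerpxx.
- by exists u1, t; split=> // V f; rewrite e.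
- exists v1, (1 - t); split; first by lra.
  by move=> V f; rewrite e lerp_swap.
Qed.

Lemma core_injective : cell_injective_on on_core center.
Proof.
move=> u v u' v' t s Du Dv Du' Dv' uv uv' t01 s01.
have [i [r [r01 E1]]] := core_cell Du Dv uv t01.
have [j [q [q01 E2]]] := core_cell Du' Dv' uv' s01.
rewrite !E1 !E2 => /(congr1 (@coords R)); rewrite !coords_lerp !coords_vec !knotS.
move=> /(knot_embedded (ltn_ord i) (ltn_ord j) r01 q01).
case=> [[/val_inj -> ->] //|[ji [-> ->]]|[ij [-> ->]]]; rewrite lerp0 lerp1.
  by congr (e (core _)); apply: val_inj; rewrite /= -ji.
by congr (e (core _)); apply: val_inj; rewrite /= -ij.
Qed.

Lemma cell_center (u v : G) : cell u v -> exists i : nat,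
  knot_int_vertex u.1 \in [:: knot_int_vertex i; knot_int_vertex i.+1] /\
  knot_int_vertex v.1 \in [:: knot_int_vertex i; knot_int_vertex i.+1].
Proof.
have kS (i : 'I_10) : knot_int_vertex (ordS i) = knot_int_vertex i.+1.
  by rewrite /knot_int_vertex /= modn_mod.
case/orP => [/eqP <-|/orP[]/eqP e].
- by exists u.1; rewrite !inE eqxx.
- by exists u.1; rewrite e kS !inE !eqxx orbT.
- by exists v.1; rewrite e kS !inE !eqxx orbT.
Qed.

Variable p : G -> 'rV[R]_3.
Hypotheses (p_core : forall v, on_core v -> p v = center v)
  (p_near : forall v j, `|p v ord0 j - center v ord0 j| < 10^-1).

Local Notation f := (drawing p).
Local Notation A := (~` range f).
Local Notation X := (set_type A).

Lemma torus_avoids i c :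
  hull [seq vec (intpt R x) | x <- torus_quad i c] `<=` A.
Proof.
move=> w hw /range_drawing[u [v [t [uv t01 wE]]]].
have [j [uj vj]] := cell_center uv.
have [n sep] := torus_separated i c j.
apply: (separated_hull sep uj vj t01 _ _ hw wE) => k;
  by rewrite -knot_intE; exact: p_near.
Qed.

(** One vertex of each cluster is kept exactly in place so that the graph contains the knot and its
    complement avoids it. *)
Lemma off_knot (x : X) : ~ on_knot (coords (\val x)).
Proof.
move=> [i [t [i10 t01 xE]]].
have := set_valP x; apply.
have -> : \val x = lerp t (p (core (Ordinal i10))) (p (core (ordS (Ordinal i10)))).
  apply: coords_inj; rewrite xE coords_lerp !p_core //= /center !coords_vec.
  by rewrite -(knotS (Ordinal i10)).
by apply: cell_range => //; rewrite /cell /= /fat_adj /= eqxx orbT.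
Qed.

Lemma torus_pt_avoids i c : A (vec (intpt R (torus_pt i c))).
Proof. by apply: (@torus_avoids i c); apply: hull_mem; rewrite inE eqxx. Qed.

(* Reducing i modulo 10 first makes [torus_point c 10] convertible to
   [torus_point c 0], so that the longitude is a loop by conversion. *)
Definition torus_point (c i : nat) : X :=
  exist (fun w => w \in A) (vec (intpt R (torus_pt (i %% 10)%N c)))
    (mem_set (@torus_pt_avoids (i %% 10)%N c)).

Lemma val_torus_point c i :
  \val (torus_point c i) = vec (intpt R (torus_pt i c)).
Proof. by rewrite /= /torus_pt modn_mod. Qed.

Lemma torus_side c : side_in (torus_point c) (torus_point c.+1).
Proof. by move=> i; rewrite !val_torus_point; exact: (@torus_avoids i c). Qed.

Lemma torus_side2 : side_in (torus_point 2) (torus_point 0).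
Proof. by move=> i; rewrite !val_torus_point; exact: (@torus_avoids i 2). Qed.

Let mer (i : nat) : {path I from torus_point 0 i to torus_point 0 i in X} :=
  meridian (@torus_side 0%N) (@torus_side 1%N) torus_side2 i.

Let lon (i : nat) := longitude_step (@torus_side 0%N) i.

Let long (n : nat) := longitude (@torus_side 0%N) n.

Let base : X := torus_point 0 0.

Let long10 : {path I from base to base in X} := long 10.

(** The endpoints agree by conversion, but the two paths carry different proofs of avoiding the
    graph; hence the pointwise comparison. *)
Lemma mer10 : (mer 10 : {path I from base to base in X}) = mer 0.
Proof.
apply/path_eqP => t.
rewrite -[LHS]/(path_concat_fun _ _ t) -[RHS]/(path_concat_fun _ _ t).
rewrite /path_concat_fun; case: ifP => _; last exact: val_inj.
rewrite -[LHS]/(path_concat_fun _ _ _) -[RHS]/(path_concat_fun _ _ _).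
by rewrite /path_concat_fun; case: ifP => _; exact: val_inj.
Qed.

Lemma meridian_longitude_commute :
  path_homotopic (path_concat (mer 0) long10) (path_concat long10 (mer 0)).
Proof.
rewrite -{2}mer10.
exact: (meridian_longitude (@torus_side 0%N) (@torus_side 1%N) torus_side2 10).
Qed.

Let cx (x : X) : R := (\val x) ord0 ord0.
Let cy (x : X) : R := (\val x) ord0 1.
Let cz (x : X) : R := (\val x) ord0 2%:R.

Let coord_val_continuous k : continuous (fun x : X => (\val x) ord0 k : R).
Proof.
apply: (Defs.ccomp (g := fun v : 'rV[R]_3 => v ord0 k)).
  by move=> v; exact: coord_continuous.
exact: val_continuous.
Qed.

Let Q := wreath mulint2 3.
Local Notation T := (book_on cx cy cz gen_a gen_b).
Local Notation carries := (carries T).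

Let T_local (x : X) : exists2 U : set X, nbhs x U & cocycle_on T U.
Proof.
apply: book_local; [exact: coord_val_continuous..|exact: gen_braid|exact: off_knot].
Qed.

Lemma torus_coords c i :
  (cx (torus_point c i), cy (torus_point c i), cz (torus_point c i)) =
  intpt R (torus_pt i c).
Proof.
rewrite -[LHS]/(coords (\val (torus_point c i))).
by rewrite val_torus_point coords_vec.
Qed.

Let segE (x y : X) (xyA : forall t, 0 <= t <= 1 -> A (lerp t (\val x) (\val y))) r :
  0 <= r <= 1 -> let z := segment_path xyA (clamp r) in
  (cx z, cy z, cz z) = lerp3 r (cx x, cy x, cz x) (cx y, cy y, cz y).
Proof.
move=> r01 /=; rewrite -[LHS]/(coords (\val (segment_path xyA (clamp r)))).
by rewrite segment_pathE clampK // coords_lerp.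
Qed.

Local Ltac run_lra :=
  rewrite !torus_coords /lerp3 /in_sector /near_page /inside /lower /upper /=;
  first [lra | apply/andP; split; [lra | apply/negP; lra]].

Local Notation by_sector i := (@carries_in_sector R X cx cy cz Q gen_a gen_b
  _ _ _ (segE _) i).
Local Notation by_outside i := (@carries_outside R X cx cy cz Q gen_a gen_b
  _ _ _ (segE _) i).
Local Notation by_through i j := (@carries_through R X cx cy cz Q gen_a gen_b
  _ _ _ (segE _) i j).

Let sector_torus j c i :
  in_sector j (intpt R (torus_pt i c)).1.1 (intpt R (torus_pt i c)).1.2 ->
  sector (cx (torus_point c i)) (cy (torus_point c i)) = j.
Proof. by move=> h; apply: sector_in; move: h; rewrite -torus_coords. Qed.

Let lon0 : carries (lon 0) 1%g.
Proof. by apply: (by_outside 2%N) => // r r01; run_lra. Qed.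
Let lon1 : carries (lon 1) 1%g.
Proof. by apply: (by_outside 1%N) => // r r01; run_lra. Qed.
(** Page 1 is crossed inside its triangle, from sector 0 to sector 1. *)
Let lon2 : carries (lon 2) gen_b.
Proof.
have e : gen_b = ((crossing gen_a gen_b 1 (0 == 1)%N)^-1 * crossing gen_a gen_b 1
    (sector (cx (torus_point 0 3)) (cy (torus_point 0 3)) == 1%N))%g.
  rewrite (@sector_torus 1%N); last by rewrite /in_sector /=; lra.
  by rewrite /crossing /= invg1 mul1g.
by rewrite [X in carries _ X]e; apply: (by_through 1%N 0%N) => // r r01; run_lra.
Qed.
Let lon3 : carries (lon 3) 1%g.
Proof. by apply: (by_outside 2%N) => // r r01; run_lra. Qed.
Let lon4 : carries (lon 4) 1%g.
Proof. by apply: (by_sector 2%N) => // r r01; run_lra. Qed.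
Let lon5 : carries (lon 5) 1%g.
Proof. by apply: (by_outside 3%N) => // r r01; run_lra. Qed.
(** Page 3 is crossed inside its triangle backwards, from sector 3 to sector 2, which inverts its
    generator [gen_a^-1]. *)
Let lon6 : carries (lon 6) gen_a.
Proof.
have e : gen_a = ((crossing gen_a gen_b 3 (3 == 3)%N)^-1 * crossing gen_a gen_b 3
    (sector (cx (torus_point 0 7)) (cy (torus_point 0 7)) == 3%N))%g.
  rewrite (@sector_torus 2%N); last by rewrite /in_sector /=; lra.
  by rewrite /crossing /= mulg1 invgK.
by rewrite [X in carries _ X]e; apply: (by_through 3%N 3%N) => // r r01; run_lra.
Qed.
Let lon7 : carries (lon 7) 1%g.
Proof. by apply: (by_outside 2%N) => // r r01; run_lra. Qed.
(** Page 2 is crossed inside its triangle, from sector 1 to sector 2. *)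
Let lon8 : carries (lon 8) (gen_a * gen_b * gen_a^-1)%g.
Proof.
have e : (gen_a * gen_b * gen_a^-1 = (crossing gen_a gen_b 2 (1 == 2)%N)^-1 *
    crossing gen_a gen_b 2
    (sector (cx (torus_point 0 9)) (cy (torus_point 0 9)) == 2%N))%g.
  rewrite (@sector_torus 2%N); last by rewrite /in_sector /=; lra.
  by rewrite /crossing /= invg1 mul1g.
by rewrite [X in carries _ X]e; apply: (by_through 2%N 1%N) => // r r01; run_lra.
Qed.
Let lon9 : carries (lon 9) 1%g.
Proof. by apply: (by_sector 2%N) => // r r01; run_lra. Qed.

Let carries_const (x : X) : carries (path_const R x) 1%g.
Proof.
have [U Ux cU] := T_local x.
have Uxx : U x by exact: nbhs_singleton.
rewrite -(cocycle_refl cU Uxx).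
by apply: (carries_cocycle cU) => t.
Qed.

Let long_carries :
  carries long10 (gen_b * gen_a * (gen_a * gen_b * gen_a^-1))%g.
Proof.
have concat := @carries_concat R X Q T.
have := concat _ _ _ _ _ _ _ (concat _ _ _ _ _ _ _ (concat _ _ _ _ _ _ _
  (concat _ _ _ _ _ _ _ (concat _ _ _ _ _ _ _ (concat _ _ _ _ _ _ _
  (concat _ _ _ _ _ _ _ (concat _ _ _ _ _ _ _ (concat _ _ _ _ _ _ _
  (concat _ _ _ _ _ _ _ (carries_const base) lon0) lon1) lon2) lon3) lon4)
  lon5) lon6) lon7) lon8) lon9.
by rewrite !mul1g !mulg1.
Qed.

(** The triangle surrounds the apex of page 3: its first side passes through the page inside the
    knot's triangle, its last side returns outside. *)
Let mer_carries : carries (mer 0) gen_a^-1%g.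
Proof.
have ab : (gen_a^-1 = (crossing gen_a gen_b 3 (2 == 3)%N)^-1 *
    crossing gen_a gen_b 3
    (sector (cx (torus_point 1 0)) (cy (torus_point 1 0)) == 3%N))%g.
  rewrite (@sector_torus 3%N); last by rewrite /in_sector /=; lra.
  by rewrite /crossing /= invg1 mul1g.
rewrite -[X in carries _ X]mulg1 -[X in carries _ X]mulg1.
apply: carries_concat; first apply: carries_concat.
- by rewrite [X in carries _ X]ab; apply: (by_through 3%N 2%N) => // r r01; run_lra.
- by apply: (by_sector 3%N) => // r r01; run_lra.
- by apply: (by_outside 3%N) => // r r01; run_lra.
Qed.

Local Open Scope quotient_scope.

Lemma fat_trefoil_not_free : ~ free_embedding f.
Proof.
(* Freeness is claimed at every base point; it is refuted at a point of the torus, where meridian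
   and longitude start. *)
move=> free; have {free} : free_group (fundamental_group R base) by exact: free.
have [phi phiE] := @transport_morphism R X Q T T_local base.
move=> free.
pose class := \pi_(fundamental_group R base).
have comm : (class (mer 0) * class long10 = class long10 * class (mer 0))%g.
  rewrite -[LHS]/(pi1_mul _ _) -[RHS]/(pi1_mul _ _) !pi1_mulE.
  by apply/loop_classP; exact: meridian_longitude_commute.
have [m2 m1] := meridian_weight; have [l2 l1] := longitude_weight.
(* At colour 2 the conclusion would read 0 * (-1) = 2 * (-1). *)
have := @free_group_commute _ _ phi _ _ 2%:R free comm.
by rewrite (phiE _ _ mer_carries) (phiE _ _ long_carries) m1 l1 => /(_ m2 l2).
Qed.

End fat_trefoil.

Theorem theorem4 (R : realType) (n : nat) (n_ge1 : (1 <= n)%N) :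
  exists G : nat -> sgraph,
    (forall i j, i <> j -> ~ sgraph_iso (G i) (G j)) /\
    (forall i, n_connected (G i) n /\
       exists f : realization R (G i) -> 'rV[R]_3,
         linear_embedding f /\ ~ free_embedding f).
Proof.
(* Clusters of [n + i] vertices: at least [n] for connectivity, and of distinct sizes, so that the
   orders of the graphs differ. *)
exists (fun i => fat_cycle (n + i)); split.
  by move=> i j ij /fat_cycle_iso /addnI.
move=> i; split; first by apply: fat_cycle_connected; rewrite n_ge1 leq_addr.
have N0 : (0 < n + i)%N by rewrite addn_gt0 n_ge1.
(* The tolerance that [separated_hull] allows for the vertices of the graph. *)
have eps : 0 < (10^-1 : R) <= 1 by lra.
pose G := fat_cycle (n + i); pose b0 : G := (ord0, Ordinal N0).
have inj := @core_injective R (n + i) N0.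
have [p [pB pnear pinj]] := @generic_placement R G _ _ b0 _ (eqxx (Ordinal N0)) eps inj.
exists (drawing p); split; first exact: drawing_linear.
exact: (fat_trefoil_not_free (N_gt0 := N0)).
Qed.
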